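(* Let $K_1$ and $K_2$ be two finite Galois extensions of $\mathbb{Q}$. Let $K_0=K_1\cap K_2$ and $L=K_1K_2$. If, for each prime number $p$, at least one of the extensions $K_i/K_0$ ($i=1,2$) is tamely ramified with respect to $p$, then $$\mathcal{P}o(L)=\varepsilon_{K_1}^L(\mathcal{P}o(K_1))+\varepsilon_{K_2}^L(\mathcal{P}o(K_2)).$$
   Context: For a number field $K$ with ring of integers $\mathcal{O}_K$ and class group $\mathcal{C}l(K)$, and for each positive integer $q$, $\Pi_q(K)$ denotes the product of all maximal ideals of $\mathcal{O}_K$ of norm $q$ (with $\Pi_q(K)=\mathcal{O}_K$ if there is none). The Pólya group $\mathcal{P}o(K)$ is the subgroup of $\mathcal{C}l(K)$ generated by the classes of all the ideals $\Pi_q(K)$, $q\ge 1$. For a finite extension $L/K$ of number fields, $\varepsilon_K^L:\mathcal{C}l(K)\to\mathcal{C}l(L)$ is the homomorphism sending the class of an ideal $I$ to the class of $I\mathcal{O}_L$. The sum of two subgroups of the abelian group $\mathcal{C}l(L)$ is the subgroup generated by them. ''$K_i/K_0$ is tamely ramified with respect to $p$'' means that $p$ does not divide the ramification index $e_p(K_i/K_0)$ of the primes of $K_i$ above $p$ over $K_0$ (this index depends only on $p$ because $K_0$ and $K_i$ are Galois over $\mathbb{Q}$); unramified is allowed. *)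

(* Defs.v *)
From HB Require Import structures.
From mathcomp Require Import all_boot all_order all_algebra all_field.
From mathcomp Require Import finmap boolp classical_sets functions cardinality.

Set Implicit Arguments.
Unset Strict Implicit.
Unset Printing Implicit Defensive.

Import GRing.Theory.

Local Open Scope classical_set_scope.
Local Open Scope card_scope.
Local Open Scope ring_scope.

(* All number fields are subfields of an ambient number field W, and their     *)
(* (fractional) ideals are subsets of W; a subset of W does not remember the   *)
(* field it lives in, whence the argument E of most definitions.               *)

Section Ideals.
Variable W : fieldExtType rat.
Implicit Types (E F : {subfield W}) (I J P : set W).

Definition ringOfIntegers E : set W :=
  [set x | x \in E /\ integralOver (intr : int -> W) x].

Definition OSubmodule E I : Prop :=
  [/\ I 0, forall x y, I x -> I y -> I (x + y)
    & forall a x, ringOfIntegers E a -> I x -> I (a * x)].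

Definition isIdeal E I : Prop := OSubmodule E I /\ I `<=` ringOfIntegers E.

Definition isMaxIdeal E I : Prop :=
  [/\ isIdeal E I, I <> ringOfIntegers E
    & forall J, isIdeal E J -> I `<=` J -> J = I \/ J = ringOfIntegers E].

Definition isFracIdeal E I : Prop :=
  [/\ OSubmodule E I, I `<=` [set x | x \in E], exists2 x, I x & x != 0
    & exists d, [/\ ringOfIntegers E d, d != 0
                  & forall x, I x -> ringOfIntegers E (d * x)]].

(* Additive subgroup generated by the products; in particular                  *)
(* mulIdeal I (ringOfIntegers E) is the extension of I to E.                   *)
Definition mulIdeal I J : set W :=
  [set x | exists n (f g : 'I_n -> W),
     [/\ forall i, I (f i), forall i, J (g i) & x = \sum_(i < n) f i * g i]].

Definition extIdeal E I : set W := mulIdeal I (ringOfIntegers E).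

Definition expIdeal E I (n : nat) : set W :=
  iter n (mulIdeal I) (ringOfIntegers E).

(* The quotient of the ring of integers of E by I has q elements. *)
Definition hasNorm E I (q : nat) : Prop :=
  [set [set x + y | y in I] | x in ringOfIntegers E] #= `I_q.

(* fset_set S lists the elements of a finite set S (and is empty if S is       *)
(* infinite, which does not happen here).                                      *)
Definition PiIdeal E (q : nat) : set W :=
  \big[mulIdeal/ringOfIntegers E]_(P <- fset_set
    [set P | isMaxIdeal E P /\ hasNorm E P q]) P.

(* Ramification index over F of a maximal ideal P of E: the exponent of P in   *)
(* the factorization of the ideal of E generated by the prime of F below P.    *)
Definition ramIndex F E P : nat :=
  xget 0%N [set e : nat | exists J,
    [/\ isIdeal E J, ~ J `<=` P
      & extIdeal E (P `&` ringOfIntegers F) = mulIdeal (expIdeal E P e) J]].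

Definition tamelyRamified F E (p : nat) : Prop :=
  forall P, isMaxIdeal E P -> P p%:R -> ~~ (p %| ramIndex F E P)%N.

(* Ideal classes are equivalence classes of fractional ideals, so the class    *)
(* group of E is a set of sets of subsets of W.                                *)
Definition idealClass E I : set (set W) :=
  [set [set a * x | x in I] | a in [set a | a \in E /\ a != 0]].

Definition classGroup E : set (set (set W)) :=
  [set idealClass E I | I in [set I | isFracIdeal E I]].

Definition mulClass (c d : set (set W)) : set (set W) :=
  [set mulIdeal I J | I in c & J in d].

Definition oneClass E : set (set W) := idealClass E (ringOfIntegers E).

Definition isSubgroup E (H : set (set (set W))) : Prop :=
  [/\ H `<=` classGroup E, H (oneClass E),
      forall c d, H c -> H d -> H (mulClass c d)
    & forall c d, H c -> classGroup E d -> mulClass c d = oneClass E -> H d].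

Definition generatedSubgroup E (X : set (set (set W))) : set (set (set W)) :=
  smallest (isSubgroup E) X.

Definition polyaGroup E : set (set (set W)) :=
  generatedSubgroup E [set idealClass E (PiIdeal E q) | q in [set q | (0 < q)%N]].

(* The class of I is sent to the class of its extension to E, for every        *)
(* representative I of c.                                                      *)
Definition extClass E (c : set (set W)) : set (set W) :=
  \bigcup_(I in c) idealClass E (extIdeal E I).

Definition sumSubgroup E (G H : set (set (set W))) : set (set (set W)) :=
  generatedSubgroup E (G `|` H).

End Ideals.

(* Main.v *)
(* Write L = K1 K2 and let p be a prime. Since L is Galois, the primes above p *)
(* are conjugate, so a Galois-stable ideal of L containing a power of p is     *)
(* determined by its common valuation at these primes: the product of the      *)
(* primes above p has valuation 1, p itself has valuation e(L/Q), and the      *)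
(* product of the primes of K_i above p extends to an ideal of valuation       *)
(* e_i = e_p(L/K_i). This gives one inclusion, and the other one follows once  *)
(* e_1 and e_2 are coprime, since powers of the class of valuation 1 are       *)
(* periodic.                                                                   *)
(* Coprimality is a form of Abhyankar's lemma. Say that K1/K0 is tame, and let *)
(* I be the inertia group of L/K2, which acts faithfully on K1. An element of  *)
(* order p in I would act wildly on K1, so p does not divide #|I|; then a      *)
(* trace produces an element of K2 of valuation #|I|, whence e_2 divides #|I|. *)
(* If a prime l divides both e_1 and e_2, take s in I of order l: as valuations*)
(* of elements of K1 are multiples of l, the tame character of s is trivial on *)
(* K1, which is impossible for an element of order prime to p.                 *)

Require Import Defs.
From HB Require Import structures.
From mathcomp Require Import all_boot all_order all_algebra all_fingroup all_solvable all_field.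
From mathcomp Require Import finmap boolp classical_sets functions cardinality.
From mathcomp Require Import ring zify.

Set Implicit Arguments.
Unset Strict Implicit.
Unset Printing Implicit Defensive.

Import Order.TTheory GRing.Theory Num.Theory.

Local Open Scope classical_set_scope.
Local Open Scope ring_scope.

(** * Integers and ideals of number fields *)

Section Integers.
Variable W : fieldExtType rat.
Implicit Types (E F : {subfield W}) (I J P : set W) (x y : W).
Local Notation OO := ringOfIntegers.

(** Everything is reduced to valuations, and these are built by hand. Quotients by ideals containing
    a prime p are finite ([exists_residues]); pigeonhole then yields local uniformizers
    ([exists_uniformizer]), hence a valuation at each prime above p. A local-to-global criterion
    ([ordIdealP]) identifies suitable ideals with [ordIdeal E p n], the integers of valuation at
    least n at all primes above p. As the Galois group permutes these primes transitively, a
    nontrivial product of all maximal ideals of given norm is some [ordIdeal E p 1]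
    ([PiIdeal_ordIdeal]), p generates some [ordIdeal E p e] ([principal_ordIdeal]), and extension
    from K_i to L sends [ordIdeal] of valuation 1 to [ordIdeal L p e_i] ([ext_ordIdeal]).

    Let c be the class of [ordIdeal L p 1]. The subgroups on the right are generated by the powers
    c^e_i, for varying p, so they lie in the Pólya group of L ([polya_ext]). Conversely c must be
    recovered from c^e_1 and c^e_2, which is possible once e_1 and e_2 are coprime
    ([subgroup_ordIdeal_coprime]).

    Coprimality ([coprime_ramification]) rests on two facts about a nontrivial automorphism s of K_1
    such that s(x)/x is congruent to 1 for all nonzero x: no exponent prime to p kills s
    ([no_tame_order]), and p divides the valuation of a fixed element ([no_tame_fixed]). Both are
    read off the leading term of s(x)/x - 1, a nonzero homomorphism from the multiplicative group to
    an additive one. The first excludes elements of prime order l other than p in the inertia group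
    of L/K_2 when l divides e_1; the second excludes elements of order p, since tameness of K_1/K_0
    provides an element of K_0 of valuation prime to p. *)

Lemma intrW_eq0 (m : int) : (m%:~R == 0 :> W) = (m == 0).
Proof.
rewrite -(rmorph_int (in_alg W)) fmorph_eq0.
by rewrite intr_eq0.
Qed.
Lemma natrW_eq0 (n : nat) : (n%:R == 0 :> W) = (n == 0)%N.
Proof. exact: (intrW_eq0 n). Qed.

Lemma OO_int E (m : int) : OO E m%:~R.
Proof. by split; [rewrite rpred_int | exact: integral_id]. Qed.
Lemma OO_nat E n : OO E n%:R. Proof. exact: (OO_int E n). Qed.
Lemma OO0 E : OO E 0. Proof. exact: (OO_nat E 0). Qed.
Lemma OO1 E : OO E 1. Proof. exact: (OO_nat E 1). Qed.
Lemma OOD E x y : OO E x -> OO E y -> OO E (x + y).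
Proof. by move=> [? ?] [? ?]; split; [rewrite rpredD | apply: integral_add]. Qed.
Lemma OON E x : OO E x -> OO E (- x).
Proof. by move=> [? ?]; split; [rewrite rpredN | apply: integral_opp]. Qed.
Lemma OOB E x y : OO E x -> OO E y -> OO E (x - y).
Proof. by move=> ? /OON; apply: OOD. Qed.
Lemma OOM E x y : OO E x -> OO E y -> OO E (x * y).
Proof. by move=> [? ?] [? ?]; split; [rewrite rpredM | apply: integral_mul]. Qed.
Lemma OOX E x n : OO E x -> OO E (x ^+ n).
Proof. by move=> h; elim: n => [|n IH]; [exact: OO1 | rewrite exprS; apply: OOM]. Qed.
Lemma OO_sum E (T : Type) (r : seq T) (Q : pred T) (f : T -> W) :
  (forall i, Q i -> OO E (f i)) -> OO E (\sum_(i <- r | Q i) f i).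
Proof. by move=> h; elim/big_ind: _ => //; [exact: OO0 | exact: OOD]. Qed.
Lemma OO_prod E (T : Type) (r : seq T) (Q : pred T) (f : T -> W) :
  (forall i, Q i -> OO E (f i)) -> OO E (\prod_(i <- r | Q i) f i).
Proof. by move=> h; elim/big_ind: _ => //; [exact: OO1 | exact: OOM]. Qed.
Lemma OO_sub E F x : (E <= F)%VS -> OO E x -> OO F x.
Proof. by move=> /subvP sEF [/sEF]. Qed.

Lemma OO_rmorph E F (s : {rmorphism W -> W}) x :
  (forall y, y \in E -> s y \in F) -> OO E x -> OO F (s x).
Proof.
move=> sE [xE [p p_monic px]]; split; first exact: sE.
exists p => //; rewrite -(_ : map_poly s (map_poly intr p) = map_poly intr p).
  by rewrite /root horner_map fmorph_eq0.
by rewrite -map_poly_comp; apply: eq_map_poly => m /=; rewrite rmorph_int.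
Qed.

(** The rational number is sent to the algebraic complex numbers, where a rational algebraic integer
    is an integer. *)
Lemma OO_rat E x : OO E x -> x \in 1%VS -> exists m : int, x = m%:~R.
Proof.
move=> [_ [p p_monic px]] /vlineP[q xq]; rewrite {}xq in px *.
have mapE (K : fieldType) (f : {rmorphism rat -> K}) :
    map_poly f (map_poly intr p) = map_poly intr p.
  by rewrite -map_poly_comp; apply: eq_map_poly => m; exact: rmorph_int.
have pq : root (map_poly intr p) q.
  by move: px; rewrite -(mapE _ (in_alg W)) /root horner_map fmorph_eq0.
have /Cint_rat_Aint : (ratr q : algC) \in Crat by rewrite Crat_rat.
have /[swap] /[apply] : (ratr q : algC) \in Aint.
  apply: (@root_monic_Aint (map_poly intr p)).
  - by rewrite -(mapE _ ratr) /root horner_map fmorph_eq0.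
  - by rewrite monic_map.
  by apply/polyOverP => i; rewrite coef_map /= rpred_int.
move=> /Num.Theory.intrP[m qm]; exists m.
have -> : q = m%:~R by apply: (fmorph_inj (ratr : {rmorphism rat -> algC})); rewrite /= qm rmorph_int.
exact: (rmorph_int (in_alg W)).
Qed.

(** x is a root of the monic polynomial X^i - X^j - b with integral coefficients. With pigeonhole,
    this turns a common denominator of all powers of x into integrality. *)
Lemma OO_pigeon_root E x (i j : nat) b : x \in E -> (j < i)%N -> OO E b ->
  x ^+ i - x ^+ j = b -> OO E x.
Proof.
move=> xE ji [_ bint] xb; split=> //.
pose q : {poly W} := 'X^i - ('X^j + b%:P).
have qs : (size ('X^j + b%:P : {poly W})%R <= i)%N.
  rewrite (leq_trans (size_polyD _ _)) // geq_max size_polyXn ji /=.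
  by rewrite (leq_trans (size_polyC_leq1 _)) //; lia.
have qm : q \is monic.
  by rewrite /q monicE lead_coefDl ?lead_coefXn ?size_polyN ?size_polyXn.
apply: (integral_root_monic qm).
  by rewrite /root !hornerE -xb; apply/eqP; ring.
apply/integral_poly => k; rewrite coefB coefD !coefXn coefC.
by do 2 ?[apply: integral_sub || apply: integral_add]; rewrite ?mulrb; 
  case: ifP => _ //; do ?[exact: integral0 | exact: integral1 | exact: integral_nat].
Qed.

Lemma OO_nat_denom E x : x \in E -> exists2 m : int, m != 0 & OO E (m%:~R * x).
Proof.
move=> xE; have /polyOver1P[q qE] := minPolyOver 1%AS x.
have q0 : q != 0.
  by apply: contraTneq (monic_minPoly 1%AS x) => q0; rewrite qE q0 rmorph0 monicE lead_coef0 eq_sym oner_eq0.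
have := root_minPoly 1%AS x; rewrite qE.
have [r [a a0 rE]] := rat_poly_scale q.
rewrite -qE => px.
have rE' : map_poly intr r = a%:~R *: q.
  by rewrite rE scalerA divff ?scale1r // intr_eq0.
have r0 : r != 0 by apply: contra_neq q0 => r0; rewrite rE r0 rmorph0 scaler0.
have rx : (map_poly intr r).[x] = 0.
  rewrite (_ : map_poly intr r = map_poly (in_alg W) (map_poly intr r)); last first.
    by rewrite -map_poly_comp; apply: eq_map_poly => m; apply/esym; exact: (rmorph_int (in_alg W)).
  by rewrite rE' linearZ /= hornerZ -qE (eqP px) mulr0.
pose n := (size r).-1; pose b := lead_coef r.
have n_gt0 : (0 < n)%N.
  rewrite lt0n; apply: contra_eq_neq rx => n0.
  have /size1_polyC rC : (size r <= 1)%N by move: n0; rewrite /n; case: (size r) => [|[]].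
  by rewrite rC map_polyC hornerC intrW_eq0 -polyC_eq0 -rC.
exists b; first by rewrite lead_coef_eq0.
split; first by rewrite rpredM // rpred_int.
(* f is chosen so that f(b X) = b^(n-1) r(X); the leading coefficient b of r is absorbed and f is
   monic. *)
pose f : {poly int} := 'X^n + \poly_(i < n) (r`_i * b ^+ (n.-1 - i)).
exists f.
  by rewrite monicE /f lead_coefDl ?lead_coefXn // size_polyXn ltnS size_poly.
have bn : (map_poly intr f).[b%:~R * x] = b%:~R ^+ n.-1 * (map_poly intr r).[x].
  rewrite /f rmorphD /= map_polyXn hornerD hornerXn.
  rewrite [map_poly intr (\poly_(i < n) _)](_ : _ = \poly_(i < n) (r`_i * b ^+ (n.-1 - i))%:~R); last first.
    by apply/polyP => i; rewrite coef_map !coef_poly /=; case: ifP.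
  rewrite horner_poly (@horner_coef_wide _ n.+1); last first.
    by rewrite (leq_trans (size_poly _ _)) // /n; case: (size r).
  rewrite big_ord_recr /= coef_map /= mulrDr addrC; congr (_ + _); last first.
    by rewrite exprMn mulrA -[in RHS]exprSr prednK.
  rewrite mulr_sumr; apply: eq_bigr => i _.
  rewrite coef_map /= rmorphM rmorphXn /= exprMn.
  have -> : b%:~R ^+ n.-1 = b%:~R ^+ (n.-1 - i) * b%:~R ^+ i :> W.
    by rewrite -exprD subnK //; have := ltn_ord i; lia.
  by ring.
by rewrite /root bn rx mulr0.
Qed.
End Integers.

Section Ideals.
Variable W : fieldExtType rat.
Implicit Types (E F : {subfield W}) (I J P Q : set W) (x y : W).
Local Notation OO := ringOfIntegers.

Section IdealTheory.
Variables (E : {subfield W}) (I : set W).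
Hypothesis idI : isIdeal E I.
Lemma ideal0 : I 0. Proof. by case: idI => -[]. Qed.
Lemma idealD x y : I x -> I y -> I (x + y). Proof. by case: idI => -[]; auto. Qed.
Lemma idealMl a x : OO E a -> I x -> I (a * x). Proof. by case: idI => -[]; auto. Qed.
Lemma idealMr a x : I x -> OO E a -> I (x * a).
Proof. by rewrite mulrC => ? ?; apply: idealMl. Qed.
Lemma ideal_sub x : I x -> OO E x. Proof. by case: idI => _; apply. Qed.
Lemma idealN x : I x -> I (- x).
Proof. by rewrite -mulN1r; apply: idealMl; apply: OON; apply: OO1. Qed.
Lemma idealB x y : I x -> I y -> I (x - y).
Proof. by move=> ? ?; apply: idealD => //; apply: idealN. Qed.
Lemma ideal_sum (T : Type) (r : seq T) (S : pred T) (f : T -> W) :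
  (forall i, S i -> I (f i)) -> I (\sum_(i <- r | S i) f i).
Proof. by move=> h; elim/big_ind: _ => //; [exact: ideal0 | exact: idealD]. Qed.
Lemma ideal1 : I 1 -> I = OO E.
Proof.
move=> I1; apply/seteqP; split=> x; first exact: ideal_sub.
by rewrite -[x in I x]mulr1 => /idealMl; apply.
Qed.
Lemma idealX x n : I x -> I (x ^+ n.+1).
Proof. by move=> Ix; rewrite exprSr; apply: idealMl => //; apply/OOX/ideal_sub. Qed.
Lemma idealBC x y z : I (x - y) -> I (y - z) -> I (x - z).
Proof. by move=> h1 h2; rewrite (_ : x - z = (x - y) + (y - z)); [exact: idealD | ring]. Qed.
End IdealTheory.

Lemma idealO E : isIdeal E (OO E).
Proof. by split=> //; split; [exact: OO0 | exact: OOD | exact: OOM]. Qed.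

Lemma ideal_principal E a : OO E a -> isIdeal E [set a * x | x in OO E].
Proof.
move=> Oa; split; first split.
- by exists 0; rewrite ?mulr0 //; apply: OO0.
- by move=> _ _ [x Ox <-] [y Oy <-]; exists (x + y); rewrite ?mulrDr //; apply: OOD.
- by move=> b _ Ob [x Ox <-]; exists (b * x); [exact: OOM | ring].
by move=> _ [x Ox <-]; apply: OOM.
Qed.

Lemma ideal_adjoin E I a : isIdeal E I -> OO E a ->
  isIdeal E [set x.1 + a * x.2 | x in I `*` OO E].
Proof.
move=> idI Oa; split; first split.
- exists (0, 0) => /=; last by rewrite mulr0 addr0.
  by split; [exact: (ideal0 idI) | exact: OO0].
- move=> _ _ [[x x'] [/= Ix Ox] <-] [[y y'] [/= Iy Oy] <-].
  exists (x + y, x' + y') => /=; last by ring.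
  by split; [exact: (idealD idI) | exact: OOD].
- move=> b _ Ob [[x x'] [/= Ix Ox] <-]; exists (b * x, b * x') => /=; last by ring.
  by split; [exact: (idealMl idI) | exact: OOM].
by move=> _ [[x x'] [/= Ix Ox] <-]; apply: OOD; [exact: (ideal_sub idI) | exact: OOM].
Qed.

Section MaxIdeal.
Variables (E : {subfield W}) (P : set W).
Hypothesis maxP : isMaxIdeal E P.
Lemma max_ideal : isIdeal E P. Proof. by case: maxP. Qed.
Lemma max_proper : ~ P 1. Proof. by move=> /(ideal1 max_ideal); case: maxP. Qed.
Lemma max_inv x : OO E x -> ~ P x -> exists2 y, OO E y & P (1 - x * y).
Proof.
move=> Ox nPx; have [idP _ /(_ _ (ideal_adjoin idP Ox))] := maxP.
case=> [z Pz||].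
- by exists (z, 0) => /=; [split=> //; exact: OO0 | rewrite mulr0 addr0].
- move=> eqP; case: nPx; rewrite -eqP; exists (0, 1) => /=; last by rewrite add0r mulr1.
  by split; [exact: ideal0 idP | exact: OO1].
move=> /seteqP[_ /(_ 1 (OO1 E))] [[z y] [/= Pz Oy] zy].
by exists y => //; rewrite -zy addrK.
Qed.
Lemma max_prime x y : OO E x -> OO E y -> P (x * y) -> P x \/ P y.
Proof.
move=> Ox Oy Pxy; have [|nPx] := pselect (P x); [by left | right].
have [z Oz Pz] := max_inv Ox nPx.
rewrite (_ : y = (1 - x * z) * y + z * (x * y)); last by ring.
have idP := max_ideal.
by apply: (idealD idP); [exact: (idealMr idP) | exact: (idealMl idP)].
Qed.
Lemma max_sub J : isIdeal E J -> P `<=` J -> ~ J 1 -> J = P.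
Proof.
move=> idJ PJ nJ1; have [_ _ /(_ _ idJ PJ)[]//] := maxP.
by move=> JO; case: nJ1; rewrite JO; apply: OO1.
Qed.
Lemma max_primeX x n : OO E x -> P (x ^+ n) -> P x.
Proof.
move=> Ox; elim: n => [/max_proper//|n IH]; rewrite exprS.
by case/(max_prime Ox (OOX _ Ox)).
Qed.
Lemma max_prime_prod (T : Type) (r : seq T) (S : pred T) (f : T -> W) :
  (forall i, S i -> OO E (f i)) -> (forall i, S i -> ~ P (f i)) ->
  ~ P (\prod_(i <- r | S i) f i).
Proof.
move=> Of nPf; suff [] : OO E (\prod_(i <- r | S i) f i) /\ ~ P (\prod_(i <- r | S i) f i) by [].
elim/big_ind: _ => [|x y [Ox nx] [Oy ny]|i Si].
- by split; [exact: OO1 | exact: max_proper].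
- by split; [exact: OOM | case/(max_prime Ox Oy)].
- by split; [exact: Of | exact: nPf].
Qed.

Section Over.
Variable p : nat.
Hypotheses (p_prime : prime p) (Pp : P p%:R).
Lemma max_int (m : int) : P m%:~R -> (p %| m)%Z.
Proof.
move=> Pm; apply: contrapT => /negP npm.
have /coprimezP[[u v] /= uv] : coprimez m p.
  by rewrite coprimezE coprime_sym prime_coprime.
apply: max_proper; have idP := max_ideal.
rewrite -[1]/(1%:~R) -uv rmorphD !rmorphM /=.
by apply: (idealD idP); apply: (idealMl idP) => //; apply: OO_int.
Qed.
Lemma max_nat (m : nat) : P m%:R -> (p %| m)%N.
Proof. exact: (@max_int m). Qed.
End Over.
End MaxIdeal.

Lemma max_neq E P Q : isMaxIdeal E P -> isMaxIdeal E Q -> P <> Q ->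
  exists2 z, P z & ~ Q z.
Proof.
move=> maxP maxQ; apply: contraPP => /forall2NP h.
have PQ : P `<=` Q by move=> z Pz; have [|/contrapT] := h z.
by rewrite (max_sub maxP (max_ideal maxQ) PQ (max_proper maxQ)).
Qed.

Lemma exists_max E I : isIdeal E I -> ~ I 1 -> exists2 P, isMaxIdeal E P & I `<=` P.
Proof.
move=> idI nI1.
(* Zorn is applied to the sets X such that X together with I is a proper ideal, so that the empty
   chain is covered: its union is empty and stands for I. *)
pose S (X : set W) := isIdeal E (X `|` I) /\ ~ (X `|` I) 1.
have [|X [[idX nX1] maxX]] := @Zorn_bigcup W S.
  move=> F FS Ftot.
  have [->|/set0P[X0 FX0]] := eqVneq F set0.
    by rewrite bigcup_set0 /S set0U.
  split; last by case=> // -[X FX X1]; have [_ []] := FS X FX; left.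
  split; first split.
  - by right; apply: ideal0 idI.
  - move=> x y xX yX.
    have [X [FX Xx Xy]] : exists X, [/\ F X, (X `|` I) x & (X `|` I) y].
      case: xX yX => [[X FX Xx]|Ix] [[Y FY Yy]|Iy].
      - have [XY|YX] := Ftot _ _ FX FY; first by exists Y; split=> //; left; auto.
        by exists X; split=> //; left; auto.
      - by exists X; split=> //; [left | right].
      - by exists Y; split=> //; [right | left].
      - by exists X0; split=> //; right.
    have [idX _] := FS X FX; have [Xxy|Ixy] := idealD idX Xx Xy; last by right.
    by left; exists X.
  - move=> a x Oa [[X FX Xx]|Ix]; last by right; apply: (idealMl idI).
    have [idX _] := FS X FX.
    have [Xax|Iax] : (X `|` I) (a * x) by apply: (idealMl idX) => //; left.
      by left; exists X.
    by right.
  - move=> x [[X FX Xx]|Ix]; last exact: ideal_sub Ix.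
    by have [idX _] := FS X FX; apply: (ideal_sub idX); left.
exists (X `|` I); last by right.
split=> // [XO|J idJ XJ]; first by case: nX1; rewrite XO; apply: OO1.
have [J1|nJ1] := pselect (J 1); [by right; apply: ideal1 | left].
have JI : J `|` I = J by apply/setUidPl => x Ix; apply: XJ; right.
apply: contrapT => neJ; apply: (maxX J); last by rewrite /S JI.
split; first by move=> x Xx; apply: XJ; left.
move=> JX; apply: neJ; apply/seteqP; split => // x Jx; left; exact: JX.
Qed.

(** Clear denominators in a rational relation, then divide by p as long as all coefficients allow
    it. This bounds the rank over F_p of the quotients in [exists_residues]. *)
Lemma int_dependent (n p : nat) (x : 'I_n -> W) : prime p -> (\dim {:W} < n)%N ->
  exists c : 'I_n -> int, \sum_i (c i)%:~R * x i = 0 /\ exists i, ~~ (p %| c i)%Z.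
Proof.
move=> pp ltn; pose X := [tuple x i | i < n].
have [k [k0 [j kj]]] : exists k : 'I_n -> rat, \sum_i k i *: x i = 0 /\ exists j, k j != 0.
  apply: contraPP ltn => nk; apply/negP; rewrite -leqNgt.
  have /eqP fX : free X.
    apply/freeP => k k0 i; apply/eqP/negPn/negP => ki; apply: nk; exists k.
    split; last by exists i.
    by rewrite -[RHS]k0; apply: eq_bigr => l _; rewrite -tnth_nth tnth_mktuple.
  by rewrite -[n](size_tuple X) -fX dimvS // subvf.
pose d := \prod_i denq (k i).
have d0 : d != 0 by apply/prodf_neq0 => i _; rewrite denq_eq0.
pose m i := numq (k i) * \prod_(l | l != i) denq (k l).
have mE i : (m i)%:~R = k i * d%:~R :> rat.
  rewrite /d (bigD1 i) //= !rmorphM /= mulrA; congr (_ * _).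
  by rewrite -{2}[k i]divq_num_den mulfVK // intr_eq0 denq_eq0.
have scaleE (a : int) (y : W) : a%:~R * y = (a%:~R : rat) *: y.
  by rewrite mulrzl scaler_int.
have m0 : \sum_i (m i)%:~R * x i = 0.
  under eq_bigr do rewrite scaleE mE mulrC -scalerA.
  by rewrite -scaler_sumr k0 scaler0.
have mj : m j != 0.
  by rewrite -(intr_eq0 rat) mE mulf_neq0 // intr_eq0.
(* Descent on the absolute value of one nonzero coefficient, which drops at each division by p. *)
move: {2}(absz _) (leqnn `|m j|%N) => N; elim: N m m0 mj {mE} => [|N IH] m m0 mj leN.
  by move: mj; rewrite -absz_eq0 -leqn0 leN.
have [[i ndv]|dvm] := pselect (exists i, ~~ (p %| m i)%Z).
  by exists m; split=> //; exists i.
have {}dvm i : (p %| m i)%Z by apply/negPn/negP => h; apply: dvm; exists i.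
pose c i := (m i %/ p)%Z.
have mE i : m i = c i * p by rewrite divzK.
have p0 : (p%:R : W) != 0 by rewrite natrW_eq0 -lt0n prime_gt0.
apply: (IH c).
- apply: (mulfI p0); rewrite mulr0 -[RHS]m0 mulr_sumr; apply: eq_bigr => i _.
  by rewrite mE rmorphM /= mulrCA mulrA [_ * p%:R]mulrC.
- by apply: contraNneq mj => c0; rewrite mE c0 mul0r.
rewrite mE abszM in leN mj.
have := prime_gt1 pp; have : (0 < `|c j|)%N.
  by rewrite absz_gt0; apply: contraNneq mj => ->; rewrite mul0r.
nia.
Qed.
End Ideals.

(** * Finiteness of the quotients by ideals containing a prime number *)

Section Residues.
Variable W : fieldExtType rat.
Implicit Types (E F : {subfield W}) (I J P Q : set W) (x y : W).
Local Notation OO := ringOfIntegers.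

Definition residues E I (T : finType) (r : T -> W) :=
  [/\ forall c, OO E (r c), forall x, OO E x -> exists c, I (x - r c)
    & forall c c', I (r c - r c') -> c = c'].

(** The quotient is a vector space over F_p. A family independent modulo I satisfies no integer
    relation with a coefficient prime to p, so its length is at most the dimension of W; the
    combinations of a maximal family with coefficients in [0, p) represent each class once. *)
Lemma exists_residues E I p : prime p -> isIdeal E I -> I p%:R ->
  exists k (r : {ffun 'I_k -> 'I_p} -> W), residues E I r.
Proof.
move=> pp idI Ip.
have Ipm m y : (p %| m)%Z -> OO E y -> I (m%:~R * y).
  move=> /dvdzP[q ->] Oy; rewrite rmorphM /= mulrAC.
  by apply: (idealMl idI) => //; apply: OOM => //; apply: OO_int.
pose indep k (f : nat -> W) := (forall i, OO E (f i)) /\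
  forall c : nat -> int, I (\sum_(i < k) (c i)%:~R * f i) ->
  forall i, (i < k)%N -> (p %| c i)%Z.
pose Q k := `[< exists f, indep k f >].
have Q0 : exists k, Q k.
  by exists 0%N; apply/asboolP; exists (fun=> 0); split=> // i; exact: OO0.
have Qle k : Q k -> (k <= \dim {:W})%N.
  move=> /asboolP[f [_ indf]]; rewrite leqNgt; apply/negP => ltk.
  have [c [c0 [i]]] := int_dependent (fun i : 'I_k => f i) pp ltk.
  pose d i := if insub i is Some j then c j else 0.
  have dE (j : 'I_k) : d j = c j by rewrite /d valK.
  rewrite -dE indf //; under eq_bigr do rewrite dE.
  by rewrite c0; exact: ideal0 idI.
case: (ex_maxnP Q0 Qle) => k /asboolP[f [Of indf]] maxk.
have p_gt0 := prime_gt0 pp.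
pose r (c : {ffun 'I_k -> 'I_p}) : W := \sum_i (c i)%:R * f i.
exists k, r; split=> [c|x Ox|c c' Icc'].
- by apply: OO_sum => i _; apply: OOM => //; apply: OO_nat.
(* By maximality, adjoining x gives a dependent family modulo I; the coefficient m of x is prime to
   p because the f i alone are independent. *)
- have [c [m Ic npm]] : exists c : nat -> int, exists2 m : int,
      I (\sum_(i < k) (c i)%:~R * f i + m%:~R * x) & ~~ (p %| m)%Z.
    pose g i := if i == k then x else f i.
    have gE (i : 'I_k) : g i = f i by rewrite /g ltn_eqF.
    have : ~ indep k.+1 g.
      move=> ig; have /maxk : Q k.+1 by apply/asboolP; exists g.
      by rewrite ltnn.
    move=> /not_andP[[]|]; first by move=> i; rewrite /g; case: ifP.
    move=> /existsNP[c /not_implyP[]]; rewrite big_ord_recr /=.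
    rewrite {2}/g eqxx; under eq_bigr do rewrite gE.
    move=> Ic /existsNP[i /not_implyP[ltik /negP ndv]].
    exists c, (c k) => //; apply: contra ndv => dv.
    have [->//|neq] := eqVneq i k.
    apply: indf; last by rewrite ltn_neqAle neq.
    by rewrite -[X in I X](addrK ((c k)%:~R * x)); apply: (idealB idI) => //; exact: Ipm.
  have /coprimezP[[u v] /= uv] : coprimez m p by rewrite coprimezE coprime_sym prime_coprime.
  have p0 : (p : int) != 0 by rewrite -lt0n.
  have ltp (n : int) : (`|(n %% p)%Z| < p)%N by lia.
  pose d i := Ordinal (ltp (- u * c i)).
  have dvd i : (p %| u * c i + (d i : nat)%:Z)%Z.
    rewrite /= gez0_abs ?modz_ge0 //; apply/dvdzP; exists (- (- u * c i %/ p)%Z).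
    by have := divz_eq (- u * c i) p; lia.
  exists [ffun i : 'I_k => d i].
  set S := \sum_(i < k) _ in Ic.
  have rE : r [ffun i : 'I_k => d i] =
      \sum_(i < k) (u * c i + (d i : nat)%:Z)%:~R * f i - u%:~R * S.
    rewrite /S mulr_sumr -sumrB; apply: eq_bigr => i _.
    by rewrite ffunE rmorphD rmorphM /=; ring.
  have xE : x = (u * m + v * p)%:~R * x by rewrite uv mul1r.
  rewrite rE {1}xE (_ : _ - _ = u%:~R * (S + m%:~R * x) + ((v * p)%:~R * x
    - \sum_(i < k) (u * c i + (d i : nat)%:Z)%:~R * f i)); last first.
    by rewrite rmorphD !rmorphM /=; ring.
  apply: (idealD idI); first by apply: (idealMl idI) => //; exact: OO_int.
  apply: (idealB idI); first by apply: Ipm => //; rewrite dvdz_mull.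
  by apply: (ideal_sum idI) => i _; apply: Ipm.
apply/ffunP => i; apply: val_inj => /=.
pose e (j : nat) := if insub j is Some j' then (c j' : nat)%:Z - (c' j' : nat)%:Z else 0.
have eE (j : 'I_k) : e j = (c j : nat)%:Z - (c' j : nat)%:Z by rewrite /e valK.
have : (p %| e i)%Z.
  apply: indf => //; rewrite (_ : \sum_(i < k) _ = r c - r c') //.
  rewrite /r -sumrB; apply: eq_bigr => j _; rewrite eE rmorphB /=; ring.
rewrite eE; have := ltn_ord (c i); have := ltn_ord (c' i).
move: (c i : nat) (c' i : nat) => a b ltb lta /dvdzP[q].
have [-> /eqP|q0] := eqVneq q 0; first by rewrite mul0r subr_eq0 => /eqP[].
nia.
Qed.

Lemma residues_hasNorm E I (T : finType) (r : T -> W) :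
  isIdeal E I -> residues E I r -> hasNorm E I #|T|.
Proof.
move=> idI [Or surj inj].
pose cs x : set W := [set x + y | y in I].
have csP x y : I (x - y) -> cs x = cs y.
  have sub u v : I (u - v) -> cs u `<=` cs v.
    move=> Iuv _ [z Iz <-]; exists (u - v + z); last by ring.
    exact: (idealD idI).
  move=> Ixy; apply/seteqP; split; apply: sub => //.
  by rewrite -opprB; apply: (idealN idI).
have csI x y : cs x = cs y -> I (x - y).
  move=> /seteqP[/(_ x) h _]; have [|z Iz zE] := h.
    by exists 0; rewrite ?addr0 //; apply: ideal0 idI.
  by rewrite -zE addrAC subrr add0r.
rewrite /hasNorm (_ : [set _ | x in _] = (cs \o r) @` [set: T]); last first.
  apply/seteqP; split => [_ [x Ox <-]|_ [c _ <-]]; last by exists (r c).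
  by have [c Ic] := surj x Ox; exists c => //=; apply/esym/csP.
apply: card_eq_trans (card_esym _).
  by apply: inj_card_eq => c c' _ _ /csI/inj.
have -> : `I_#|T| = (fun c : T => enum_rank c : nat) @` [set: T].
  apply/seteqP; split=> [n /= ltn|_ [c _ <-]] /=; last exact: ltn_ord.
  by exists (enum_val (Ordinal ltn)) => //; rewrite enum_valK.
by apply: inj_card_eq => c c' _ _ /val_inj/enum_rank_inj.
Qed.

Lemma hasNorm_inj E I q q' : hasNorm E I q -> hasNorm E I q' -> q = q'.
Proof. by move=> /card_esym h /(card_eq_trans h)/card_eq_II. Qed.

Lemma residue_pigeonhole E I p (x : nat -> W) : prime p -> isIdeal E I -> I p%:R ->
  (forall n, OO E (x n)) -> exists i j, (i < j)%N /\ I (x i - x j).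
Proof.
move=> pp idI Ip Ox; have [k [r [Or surj inj]]] := exists_residues pp idI Ip.
have /choice[f fP] n : exists c, I (x n - r c) by apply: surj.
have [i [j [ltij fij]]] : exists i j, (i < j)%N /\ f i = f j.
  pose g (i : 'I_#|{ffun 'I_k -> 'I_p}|.+1) := f i.
  have : ~ injective g by move=> /leq_card; rewrite card_ord ltnn.
  move=> /existsNP[i /existsNP[j /not_implyP[gij /eqP neq]]].
  have /orP[lt|lt] : (i < j)%N || (j < i)%N by rewrite -neq_ltn.
    by exists i, j.
  by exists j, i.
exists i, j; split=> //; apply: (idealBC idI (fP i)); rewrite fij -opprB.
exact: (idealN idI (fP j)).
Qed.

Lemma exists_cycle E P I p x : prime p -> isIdeal E I -> I p%:R -> isIdeal E P ->
  ~ P 1 -> P x -> exists n t, [/\ OO E t, ~ P t & I (x ^+ n * t)].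
Proof.
move=> pp idI Ip idP nP1 Px; have Ox := ideal_sub idP Px.
have [i [j [ltij Iij]]] := residue_pigeonhole pp idI Ip (fun n => OOX n Ox).
exists i, (1 - x ^+ (j - i)); split.
- by apply: OOB; [exact: OO1 | exact: OOX].
- move=> Pt; apply: nP1; rewrite -(subrK (x ^+ (j - i)) 1); apply: (idealD idP) => //.
  by rewrite -(prednK (n := j - i)) ?subn_gt0 //; apply: (idealX idP).
by rewrite mulrBr mulr1 -exprD subnKC // ltnW.
Qed.

(** A finite domain is a field: for x outside P, two powers of x agree modulo P, and cancelling the
    smaller one makes x invertible modulo P. *)
Lemma prime_ideal_max E P p : prime p -> isIdeal E P -> P p%:R -> ~ P 1 ->
  (forall x y, OO E x -> OO E y -> P (x * y) -> P x \/ P y) -> isMaxIdeal E P.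
Proof.
move=> pp idP Pp nP1 primeP; split=> [//|PO|J idJ PJ].
  by apply: nP1; rewrite PO; apply: OO1.
have [J1|nJ1] := pselect (J 1); [by right; apply: ideal1 | left].
apply/seteqP; split=> // x Jx; apply: contrapT => nPx; apply: nJ1.
have Ox := ideal_sub idJ Jx.
have [i [j [ltij Pij]]] := residue_pigeonhole pp idP Pp (fun n => OOX n Ox).
have nPX n : ~ P (x ^+ n).
  by elim: n => // n IH; rewrite exprS => /primeP[]//; apply: OOX.
have : P (x ^+ i * (1 - x ^+ (j - i))) by rewrite mulrBr mulr1 -exprD subnKC // ltnW.
case/primeP => [|||/PJ J1].
- exact: OOX.
- by apply: OOB; [exact: OO1 | exact: OOX].
- by move/nPX.
rewrite -(subrK (x ^+ (j - i)) 1); apply: (idealD idJ) => //.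
by rewrite -(prednK (n := j - i)) ?subn_gt0 //; apply: (idealX idJ).
Qed.

Lemma max_restrict E F P p : (F <= E)%VS -> prime p -> isMaxIdeal E P -> P p%:R ->
  isMaxIdeal F (P `&` OO F).
Proof.
move=> sFE pp maxP Pp; have idP := max_ideal maxP.
have sO x : OO F x -> OO E x by apply: OO_sub.
apply: (@prime_ideal_max _ _ p) => //.
- split=> [|x []//]; split=> [|x y [Px Ox] [Py Oy]|a x Oa [Px Ox]].
  + by split; [exact: ideal0 idP | exact: OO0].
  + by split; [exact: (idealD idP) | exact: OOD].
  + by split; [apply: (idealMl idP) => //; exact: sO | exact: OOM].
- by split=> //; exact: OO_nat.
- by case=> /(max_proper maxP).
move=> x y Ox Oy [/(max_prime maxP (sO _ Ox) (sO _ Oy)) [Px|Py] _]; by [left | right].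
Qed.

Lemma max_hasNorm E P p : prime p -> isMaxIdeal E P -> P p%:R ->
  exists k, (0 < k)%N /\ hasNorm E P (p ^ k).
Proof.
move=> pp maxP Pp; have idP := max_ideal maxP.
have [k [r res]] := exists_residues pp idP Pp; exists k; split; last first.
  by have := residues_hasNorm idP res; rewrite card_ffun !card_ord.
case: k r res => // r [_ surj _]; case: (max_proper maxP).
have [c h1] := surj 1 (OO1 E); have [d h0] := surj 0 (OO0 E).
rewrite -[1]subr0; apply: (idealBC idP h1); rewrite (_ : c = d).
  by rewrite -opprB; exact: (idealN idP h0).
by apply/ffunP => -[].
Qed.
End Residues.

(** * Galois action on the primes *)

Section Conjugation.
Variable W : fieldExtType rat.
Implicit Types (E F : {subfield W}) (I J P Q : set W) (x y : W).
Local Notation OO := ringOfIntegers.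

Lemma max_separate E Q (s : seq (set W)) : isMaxIdeal E Q ->
  (forall P, P \in s -> isMaxIdeal E P) -> Q \notin s ->
  exists y, [/\ OO E y, ~ Q y & forall P, P \in s -> P y].
Proof.
move=> maxQ; elim: s => [|P s IH] maxs.
  by exists 1; split=> //; [exact: OO1 | exact: (max_proper maxQ)].
rewrite inE negb_or => /andP[/eqP QP Qs].
have [|y [Oy nQy sy]] := IH _ Qs; first by move=> R Rs; apply: maxs; rewrite inE Rs orbT.
have maxP : isMaxIdeal E P by apply: maxs; rewrite mem_head.
have [z Pz nQz] := max_neq maxP maxQ (nesym QP).
have Oz := ideal_sub (max_ideal maxP) Pz.
exists (z * y); split; first exact: OOM.
  by case/(max_prime maxQ Oz Oy).
move=> R; rewrite inE => /predU1P[->|Rs].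
  by apply: (idealMr (max_ideal maxP)).
have maxR : isMaxIdeal E R by apply: maxs; rewrite inE Rs orbT.
by apply: (idealMl (max_ideal maxR)) => //; apply: sy.
Qed.

(** Induction on s. If the element x found for the tail falls in P, it is corrected by y z with y in
    Q outside P, and z outside P but in every ideal of the tail. *)
Lemma prime_avoidance E Q (s : seq (set W)) : isMaxIdeal E Q ->
  (forall P, P \in s -> isMaxIdeal E P) -> Q \notin s ->
  exists x, Q x /\ forall P, P \in s -> ~ P x.
Proof.
move=> maxQ; have idQ := max_ideal maxQ; elim: s => [|P s IH] maxs.
  by exists 0; split=> //; exact: ideal0 idQ.
rewrite inE negb_or => /andP[/eqP QP Qs].
have {}maxs R : R \in P :: s -> isMaxIdeal E R by exact: maxs.
have maxs' R : R \in s -> isMaxIdeal E R by move=> Rs; apply: maxs; rewrite inE Rs orbT.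
have maxP : isMaxIdeal E P by apply: maxs; rewrite mem_head.
have [x [Qx sx]] := IH maxs' Qs; have Ox := ideal_sub idQ Qx.
have [nPx|/contrapT Px] := pselect (~ P x).
  by exists x; split=> // R; rewrite inE => /predU1P[-> // | /sx].
have Ps : P \notin s by apply/negP => /sx.
have [z [Oz nPz sz]] := max_separate maxP maxs' Ps.
have [y Qy nPy] := max_neq maxQ maxP QP; have Oy := ideal_sub idQ Qy.
exists (x + y * z); split; first by apply: (idealD idQ) => //; by apply: (idealMr idQ).
move=> R; rewrite inE => /predU1P[->|Rs].
  move=> /(idealB (max_ideal maxP))/(_ Px); rewrite addrAC subrr add0r.
  by case/(max_prime maxP Oy Oz).
have idR := max_ideal (maxs' R Rs); move=> Rxyz; apply: (sx R Rs).
by rewrite -(addrK (y * z) x); apply: (idealB idR) => //; apply: (idealMl idR) => //; exact: sz.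
Qed.

Section Conj.
Variables (E : {subfield W}) (s t : {rmorphism W -> W}).
Hypotheses (sE : forall x, x \in E -> s x \in E) (tE : forall x, x \in E -> t x \in E).
Hypotheses (sK : {in E, cancel s t}) (tK : {in E, cancel t s}).

Lemma OO_conj x : OO E x -> OO E (s x). Proof. exact: OO_rmorph. Qed.
Lemma OO_conjV x : OO E x -> OO E (t x). Proof. exact: OO_rmorph. Qed.

Lemma conjP I x : isIdeal E I -> (s @` I) x <-> OO E x /\ I (t x).
Proof.
move=> idI; split=> [[y Iy <-]|[Ox Itx]].
  have Oy := ideal_sub idI Iy; rewrite sK; last by case: Oy.
  by split=> //; exact: OO_conj.
by exists (t x) => //; rewrite tK //; case: Ox.
Qed.

Lemma ideal_conj I : isIdeal E I -> isIdeal E (s @` I).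
Proof.
move=> idI; split; first split.
- by exists 0; rewrite ?rmorph0 //; exact: ideal0 idI.
- by move=> _ _ [x Ix <-] [y Iy <-]; exists (x + y); rewrite ?rmorphD //; by apply: (idealD idI).
- move=> a _ Oa [x Ix <-]; exists (t a * x); last by rewrite rmorphM tK //; case: Oa.
  by apply: (idealMl idI) => //; exact: OO_conjV.
by move=> _ [x Ix <-]; apply/OO_conj/(ideal_sub idI).
Qed.

Lemma residues_conj I (T : finType) (r : T -> W) : isIdeal E I ->
  residues E I r -> residues E (s @` I) (s \o r).
Proof.
move=> idI [Or surj inj]; split=> [c|x Ox|c c'] /=; first exact: OO_conj.
  have [c Ic] := surj _ (OO_conjV Ox); exists c; exists (t x - r c) => //.
  by rewrite rmorphB tK //; case: Ox.
rewrite -rmorphB => /(conjP _ idI)[_]; rewrite sK; first exact: inj.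
by rewrite rpredB //; [case: (Or c) | case: (Or c')].
Qed.
End Conj.

Lemma max_conj E (s t : {rmorphism W -> W}) P :
  (forall x, x \in E -> s x \in E) -> (forall x, x \in E -> t x \in E) ->
  {in E, cancel s t} -> {in E, cancel t s} ->
  isMaxIdeal E P -> isMaxIdeal E (s @` P).
Proof.
move=> sE tE sK tK maxP; have idP := max_ideal maxP.
have idsP : isIdeal E (s @` P) by exact: (ideal_conj sE tE tK).
split=> // [|J idJ PJ].
  move=> PO; have : (s @` P) 1 by rewrite PO; apply: OO1.
  by case/(conjP sE sK tK _ idP) => _; rewrite rmorph1; exact: (max_proper maxP).
have [J1|nJ1] := pselect (J 1); [by right; apply: ideal1 | left].
have tJP : t @` J = P.
  apply: (max_sub maxP); first exact: (ideal_conj tE sE sK).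
    move=> x Px; apply/(conjP tE tK sK _ idJ).
    by split; [exact: ideal_sub Px | apply: PJ; exists x].
  by case/(conjP tE tK sK _ idJ) => _; rewrite rmorph1.
apply/seteqP; split=> // x Jx; apply/(conjP sE sK tK _ idP); split.
  exact: ideal_sub Jx.
by rewrite -tJP; exists x.
Qed.
End Conjugation.

Section Galois.
Variable W : splittingFieldType rat.
Implicit Types (K : {subfield W}) (P Q : set W).
Local Notation OO := ringOfIntegers.

Lemma gal_cancel K (u : gal_of K) : {in K, cancel u (u^-1)%g}.
Proof. by move=> x xK; rewrite -galM // mulgV gal_id. Qed.
Lemma gal_cancelV K (u : gal_of K) : {in K, cancel (u^-1)%g u}.
Proof. by move=> x xK; rewrite -galM // mulVg gal_id. Qed.

Lemma max_gal K (u : gal_of K) P : isMaxIdeal K P -> isMaxIdeal K (u @` P).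
Proof.
have um (v : gal_of K) y : y \in K -> v y \in K by apply: memv_gal.
exact: (@max_conj _ K (gal_repr u) (gal_repr (u^-1)%g) P (um u) (um _) (@gal_cancel _ u) (@gal_cancelV _ u)).
Qed.

Lemma galNorm_int K x : galois 1%AS K -> OO K x ->
  exists m : int, galNorm 1%AS K x = m%:~R.
Proof.
move=> galK Ox; apply: (@OO_rat _ K).
  by apply: OO_prod => u _; apply: OO_rmorph Ox => y; apply: memv_gal.
by apply: mem_galNorm => //; case: Ox.
Qed.

(** Otherwise some x in Q avoids all conjugates of P. Its norm is an integer of Q, so a multiple of
    p, so an element of P; then some conjugate of x lies in P, that is, x lies in a conjugate of
    P. *)
Lemma max_transitive K p P Q : galois 1%AS K -> prime p ->
  isMaxIdeal K P -> isMaxIdeal K Q -> P p%:R -> Q p%:R ->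
  exists u : gal_of K, Q = u @` P.
Proof.
move=> galK pp maxP maxQ Pp Qp; apply: contrapT => nQ.
pose s := [seq [set u x | x in P] | u : gal_of K].
have [||x [Qx sx]] := @prime_avoidance _ K Q s maxQ.
- by move=> R /mapP[u _ ->]; apply: max_gal.
- by apply/negP => /mapP[u _ Qu]; apply: nQ; exists u.
have Ox := ideal_sub (max_ideal maxQ) Qx.
have [m mE] := galNorm_int galK Ox.
have Ou (u : gal_of K) : OO K (u x) by apply: OO_rmorph Ox => y; apply: memv_gal.
have Qm : Q m%:~R.
  rewrite -mE /galNorm (bigD1 1%g) ?group1 //= gal_id.
  by apply: (idealMr (max_ideal maxQ)) => //; apply: OO_prod => u _.
have /dvdzP[q mq] := max_int maxQ pp Qp Qm.
have : P m%:~R.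
  by rewrite mq rmorphM; apply: (idealMl (max_ideal maxP)) => //; exact: OO_int.
rewrite -mE; apply: (max_prime_prod maxP) => // u _ Pux.
apply: (sx ((u^-1)%g @` P)); first by apply/mapP; exists (u^-1)%g; rewrite ?mem_enum.
by exists (u x) => //; rewrite gal_cancel //; case: Ox.
Qed.

Lemma hasNorm_transitive K p P Q q : galois 1%AS K -> prime p ->
  isMaxIdeal K P -> isMaxIdeal K Q -> P p%:R -> Q p%:R ->
  hasNorm K P q -> hasNorm K Q q.
Proof.
move=> galK pp maxP maxQ Pp Qp Pq; have [u QE] := max_transitive galK pp maxP maxQ Pp Qp.
have idP := max_ideal maxP; have [k [r res]] := exists_residues pp idP Pp.
rewrite (hasNorm_inj Pq (residues_hasNorm idP res)).
apply: (residues_hasNorm (max_ideal maxQ) (r := u \o r)); rewrite QE.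
have um (v : gal_of K) y : y \in K -> v y \in K by apply: memv_gal.
exact: (@residues_conj _ K (gal_repr u) (gal_repr (u^-1)%g) (um u) (um _) (@gal_cancel _ u) (@gal_cancelV _ u)).
Qed.

Lemma max_finite K p : galois 1%AS K -> prime p ->
  finite_set [set P | isMaxIdeal K P /\ P p%:R].
Proof.
move=> galK pp.
have [->|/set0P[P [maxP Pp]]] := eqVneq [set P | isMaxIdeal K P /\ P p%:R] set0.
  exact: finite_set0.
apply: (@sub_finite_set _ _ [set u @` P | u in [set: gal_of K]]); last first.
  exact/finite_image/finite_finset.
by move=> Q [maxQ Qp]; have [u ->] := max_transitive galK pp maxP maxQ Pp Qp; exists u.
Qed.

Lemma max_nat_multiple K x : galois 1%AS K -> OO K x -> x != 0 ->
  exists m y, [/\ (0 < m)%N, OO K y & x * y = m%:R].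
Proof.
move=> galK Ox x0; have [m mE] := galNorm_int galK Ox.
have m0 : m != 0.
  by rewrite -(intrW_eq0 W) -mE galNorm_eq0.
pose y := \prod_(u in 'Gal(K / 1%AS)%g | u != 1%g) u x : W.
have Oy : OO K y by apply: OO_prod => u _; apply: OO_rmorph Ox => z; apply: memv_gal.
have xy : x * y = m%:~R by rewrite -mE /galNorm (bigD1 1%g) ?group1 //= gal_id.
have : m%:~R = (-1) ^+ (m < 0)%R * `|m|%N%:R :> W.
  by rewrite {1}[m]intEsign rmorphM rmorphXn rmorphN1.
move=> mE'; exists `|m|%N, ((-1) ^+ (m < 0)%R * y); split; first by rewrite absz_gt0.
  by apply: OOM => //; apply/OOX/OON/OO1.
by rewrite mulrCA xy mE' signrMK.
Qed.

Lemma OO_nat_inv K n y : OO K y -> n%:R * y = 1 -> n = 1%N.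
Proof.
move=> Oy ny; have n0 : n%:R != 0 :> W.
  by apply: contra_eq_neq ny => ->; rewrite mul0r eq_sym oner_neq0.
have yE : y = (n%:R : rat)^-1%:A.
  apply: (mulfI n0); rewrite ny mulr_natl scalerMnl -mulr_natl divff ?scale1r //.
  by move: n0; rewrite natrW_eq0 pnatr_eq0.
have [m ym] : exists m : int, y = m%:~R.
  by apply: OO_rat Oy _; rewrite yE; apply/rpredZ/rpred1.
have : (n%:Z * m - 1)%:~R == 0 :> W by rewrite rmorphB rmorphM /= -ym ny subrr.
rewrite intrW_eq0 subr_eq0 => /eqP nm.
have := congr1 absz nm; rewrite abszM /= => /eqP.
by rewrite muln_eq1 => /andP[/eqP].
Qed.

Lemma exists_max_over K p : prime p -> exists2 P, isMaxIdeal K P & P p%:R.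
Proof.
move=> pp; have [|P maxP pP] := exists_max (ideal_principal (OO_nat K p)).
  by case=> y Oy py; move: pp; rewrite (OO_nat_inv Oy py).
by exists P => //; apply: pP; exists 1; rewrite ?mulr1 //; exact: OO1.
Qed.

Lemma max_over_prime K P : galois 1%AS K -> isMaxIdeal K P -> exists2 p, prime p & P p%:R.
Proof.
move=> galK maxP; have idP := max_ideal maxP.
have [x Px x0] : exists2 x, P x & x != 0.
  apply: contrapT => nx.
  have P0 x : P x -> x = 0 by move=> Px; apply/eqP/negPn/negP => x0; apply: nx; exists x.
  (* A zero P would be contained in the proper ideal generated by 2, hence equal to it by
     maximality, and 2 would be zero. *)
  have id2 := ideal_principal (OO_nat K 2).
  have PE : [set 2%:R * x | x in OO K] = P.
    apply: (max_sub maxP id2).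
    - by move=> x /P0 ->; exists 0; rewrite ?mulr0 //; exact: OO0.
    by case=> y Oy /(OO_nat_inv Oy).
  have : P 2%:R by rewrite -PE; exists 1; rewrite ?mulr1 //; exact: OO1.
  by move/P0/eqP; rewrite natrW_eq0.
have [m [y [m0 Oy xy]]] := max_nat_multiple galK (ideal_sub idP Px) x0.
have : P m%:R by rewrite -xy; apply: (idealMr idP).
rewrite {1}(prod_prime_decomp m0) big_seq natr_prod => Pm.
apply: contrapT => np; apply: (max_prime_prod maxP) Pm => -[q e] qe.
  exact: OO_nat.
rewrite natrX => /(max_primeX maxP (OO_nat _ _)) Pq; apply: np; exists q => //.
by have [] := mem_prime_decomp qe.
Qed.
End Galois.

(** * The valuation of a prime *)

Section Valuation.
Variable W : splittingFieldType rat.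
Implicit Types (E K : {subfield W}) (P Q I : set W).
Local Notation OO := ringOfIntegers.

(** The localization at P is never formed: denominators s outside P describe its units, its elements
    ([locInt]) and the generators of its maximal ideal ([uniformizer]). *)
Definition locUnit E P : set W :=
  [set x | exists s t, [/\ OO E s /\ ~ P s, OO E t /\ ~ P t & s * x = t]].
Definition locInt E P : set W :=
  [set x | exists s, [/\ OO E s, ~ P s & OO E (s * x)]].
Definition uniformizer E P (a : W) : Prop :=
  P a /\ forall b, P b -> exists s c, [/\ OO E s, ~ P s, OO E c & s * b = a * c].
(* val E P x is meaningful only for nonzero x in E; vge treats 0 as having *)
(* infinite valuation.                                                     *)
Definition val E P (x : W) : int :=
  xget 0 [set n | exists a u, [/\ uniformizer E P a, locUnit E P u & x = a ^ n * u]].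
Definition vge E P (n : int) : set W := [set x | x \in E /\ (x = 0 \/ (n <= val E P x)%R)].

Section Local.
Variables (E : {subfield W}) (P : set W) (p : nat).
Hypotheses (maxP : isMaxIdeal E P) (pp : prime p) (Pp : P p%:R).
Let idP := max_ideal maxP.
Let p0 : p%:R != 0 :> W. Proof. by rewrite natrW_eq0 -lt0n prime_gt0. Qed.
Local Notation U x := (OO E x /\ ~ P x).

Lemma nP_neq0 x : ~ P x -> x != 0.
Proof. by apply: contra_notN => /eqP ->; exact: ideal0 idP. Qed.
Lemma nP1 : U 1. Proof. by split; [exact: OO1 | exact: max_proper maxP]. Qed.
Lemma nPM x y : U x -> U y -> U (x * y).
Proof.
by move=> [Ox nx] [Oy ny]; split; [exact: OOM | case/(max_prime maxP Ox Oy)].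
Qed.
Lemma nPX x n : U x -> U (x ^+ n).
Proof. by move=> Ux; elim: n => [|n IH]; [exact: nP1 | rewrite exprS; exact: nPM]. Qed.

(* A nonzero element of the annihilator of P modulo p, divided by p: it lies *)
(* in the inverse of P but is not integral.                                  *)
Lemma exists_annihilator : exists2 a, OO E a &
  (forall x, P x -> OO E (a / p%:R * x)) /\ ~ OO E (a / p%:R).
Proof.
pose I := [set p%:R * x | x in OO E].
have idI : isIdeal E I by apply/ideal_principal/OO_nat.
have Ip : I p%:R by exists 1; rewrite ?mulr1 //; exact: OO1.
have IP : I `<=` P by move=> _ [x Ox <-]; exact: (idealMr idP).
(* [tors a] says that a vanishes in the localization at P of the integers modulo p. *)
pose tors a := exists s, U s /\ I (s * a).
have torsM b a : OO E b -> tors a -> tors (b * a).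
  by move=> Ob [s [Us Isa]]; exists s; split=> //; rewrite mulrCA; apply: (idealMl idI).
(* Every x in P is nilpotent in this local ring, so a can be multiplied by the last power of x that
   does not kill it. Once the list is exhausted, a is still nonzero and is killed by all its
   members. *)
have step (l : seq W) : (forall x, x \in l -> P x) ->
    exists2 a, OO E a & ~ tors a /\ forall x, x \in l -> tors (a * x).
  elim: l => [|x l IH] Pl.
    exists 1; [exact: OO1 | split=> // -[s [[_ nPs]]]].
    by rewrite mulr1 => /IP.
  have [|a Oa [na la]] := IH; first by move=> y yl; apply: Pl; rewrite inE yl orbT.
  have Px : P x by apply: Pl; rewrite mem_head.
  have Ox := ideal_sub idP Px.
  have [n [t [Ot nPt It]]] := exists_cycle pp idI Ip idP (max_proper maxP) Px.
  have ex : exists k, `[< tors (a * x ^+ k) >].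
    by exists n; apply/asboolP/torsM => //; exists t; rewrite mulrC.
  case: (ex_minnP ex) => -[|k] /asboolP tk mink; first by rewrite mulr1 in tk.
  exists (a * x ^+ k); first by apply/OOM => //; exact: OOX.
  split=> [tk'|y].
    by have /mink : `[< tors (a * x ^+ k) >] by [apply/asboolP]; rewrite ltnn.
  rewrite inE => /predU1P[->|yl]; first by rewrite -mulrA -exprSr.
  by rewrite mulrAC mulrC; apply: torsM (la y yl); exact: OOX.
(* Modulo p, finitely many representatives of the elements of P suffice, so the product of their
   denominators serves for all of P. *)
have [k [r [Or surj _]]] := exists_residues pp idI Ip.
have [|a Oa [na la]] := step [seq r c | c <- enum {: {ffun 'I_k -> 'I_p}} & `[< P (r c) >]].
  by move=> x /mapP[c]; rewrite mem_filter => /andP[/asboolP Pc _] ->.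
have /choice[f fP] c : exists s, U s /\ (P (r c) -> I (s * (a * r c))).
  have [Pc|nPc] := pselect (P (r c)); last by exists 1; split=> //; exact: nP1.
  have [|s [Us Is]] := la (r c); last by exists s.
  by apply/mapP; exists c => //; rewrite mem_filter mem_enum andbT; apply/asboolP.
pose s := \prod_c f c.
have Us : U s.
  split; first by apply: OO_prod => c _; have [[]] := fP c.
  by apply: (max_prime_prod maxP) => c _; have [[]] := fP c.
have Os : OO E s by case: Us.
exists (s * a); first exact: OOM.
have divI y : I y -> OO E (y / p%:R) by move=> [z Oz <-]; rewrite mulrC mulKf.
split=> [x Px|Osap].
  have Ox := ideal_sub idP Px; have [c Ic] := surj x Ox.
  rewrite mulrAC; apply: divI.
  have Pc : P (r c) by rewrite -(subKr x (r c)); apply: (idealB idP) => //; exact: IP.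
  rewrite (_ : s * a * x = s * a * (x - r c) + \prod_(d | d != c) f d * (f c * (a * r c))); last first.
    by rewrite /s (bigD1 c) //=; ring.
  apply: (idealD idI); first by apply: (idealMl idI) => //; exact: OOM.
  have [_ Ifc] := fP c; apply: (idealMl idI); last exact: Ifc.
  by apply: OO_prod => d _; have [[]] := fP d.
apply: na; exists s; split=> //; exists (s * a / p%:R) => //.
by rewrite mulrC divfK.
Qed.

(** For g = a/p as in [exists_annihilator], g P consists of integers but g is not one. Were g P
    inside P, g would be integral; so g b is outside P for some b in P, and b generates P locally
    because (g b) x = b (g x). *)
Lemma exists_uniformizer : exists a, uniformizer E P a.
Proof.
have [a Oa [aP nOa]] := exists_annihilator; set g := a / p%:R in aP nOa.
have gE : g \in E by rewrite rpred_div //; [case: Oa | exact: rpred_nat].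
have [b Pb nPgb] : exists2 b, P b & ~ P (g * b).
  apply: contrapT => ngP.
  (* All powers of g have denominator p, so two of them agree modulo integers. *)
  have {}ngP b : P b -> P (g * b).
    by move=> Pb; apply: contrapT => nPb; apply: ngP; exists b.
  apply: nOa.
  pose I := [set p%:R * x | x in OO E].
  have idI : isIdeal E I by apply/ideal_principal/OO_nat.
  have Ip : I p%:R by exists 1; rewrite ?mulr1 //; exact: OO1.
  have Pgn n : P (g ^+ n * p%:R).
    by elim: n => [|n IH]; rewrite ?mul1r // exprS -mulrA; exact: ngP.
  have [i [j [ltij [c Oc cE]]]] := residue_pigeonhole pp idI Ip (fun n => ideal_sub idP (Pgn n)).
  apply: (OO_pigeon_root gE ltij (OON Oc)).
  by apply: (mulIf p0); rewrite mulrBl mulNr [c * _]mulrC cE opprB.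
exists b; split=> // x Px; exists (g * b), (g * x).
by split; [exact: aP | exact: nPgb | exact: aP | ring].
Qed.

Lemma locUnitM x y : locUnit E P x -> locUnit E P y -> locUnit E P (x * y).
Proof.
move=> [s [t [Us Ut st]]] [s' [t' [Us' Ut' st']]].
by exists (s * s'), (t * t'); split; [exact: nPM | exact: nPM | rewrite -st -st'; ring].
Qed.
Lemma locUnit_neq0 x : locUnit E P x -> x != 0.
Proof.
move=> [s [t [_ [_ /nP_neq0 t0] st]]]; move: t0.
by rewrite -st mulf_eq0 negb_or => /andP[].
Qed.
Lemma locUnitV x : locUnit E P x -> locUnit E P x^-1.
Proof.
move=> ux; have x0 := locUnit_neq0 ux; case: ux => s [t [Us Ut st]].
by exists t, s; split=> //; rewrite -st mulfK.
Qed.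
Lemma locUnit_nP x : U x -> locUnit E P x.
Proof. by move=> Ux; exists 1, x; split; rewrite ?mul1r //; exact: nP1. Qed.
Lemma locUnit_exprz x (n : int) : locUnit E P x -> locUnit E P (x ^ n).
Proof.
move=> ux; have uX (k : nat) : locUnit E P (x ^+ k).
  by elim: k => [|k IH]; [exact: locUnit_nP nP1 | rewrite exprS; exact: locUnitM].
by case: n => k; [exact: uX | exact/locUnitV/uX].
Qed.
Lemma locUnit_mem x : locUnit E P x -> x \in E.
Proof.
move=> [s [t [[[sE _] nPs] [[tE _] _] st]]]; rewrite -(mulKf (nP_neq0 nPs) x) st.
by rewrite rpredM ?rpredV.
Qed.

Lemma uniformizer_neq0 a : uniformizer E P a -> a != 0.
Proof.
move=> [_ /(_ _ Pp)[s [c [_ /nP_neq0 s0 _]]]]; apply: contra_eq_neq => ->.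
by rewrite mul0r mulf_neq0.
Qed.
Lemma uniformizer_O a : uniformizer E P a -> OO E a.
Proof. by case=> /(ideal_sub idP). Qed.
Lemma uniformizer_mem a : uniformizer E P a -> a \in E.
Proof. by move=> /uniformizer_O[]. Qed.

Lemma uniformizer_assoc a b : uniformizer E P a -> uniformizer E P b ->
  exists2 u, locUnit E P u & a = b * u.
Proof.
move=> ua ub; have a0 := uniformizer_neq0 ua; have b0 := uniformizer_neq0 ub.
have [[Pa /(_ _ ub.1)[s [c [Os nPs Oc sE]]]] [Pb /(_ _ ua.1)[s' [c' [Os' nPs' Oc' s'E]]]]] := (ua, ub).
have cc : s * s' = c * c'.
  apply: (mulfI a0); apply: (mulfI b0).
  by transitivity ((s * b) * (s' * a)); [ring | rewrite sE s'E; ring].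
have nPc' : ~ P c'.
  move=> Pc'; have [_] := nPM (conj Os nPs) (conj Os' nPs'); apply.
  by rewrite cc; apply: (idealMl idP).
exists (c' / s'); last by rewrite mulrA -s'E mulrC mulKf // nP_neq0.
by exists s', c'; split=> //; rewrite mulrC divfK // nP_neq0.
Qed.

Lemma nP_exprz a u (n : int) : uniformizer E P a -> locUnit E P u -> (0 < n)%R ->
  a ^ n = u -> False.
Proof.
move=> ua [s [t [[Os nPs] [Ot nPt] st]]] n0 aE.
case: n n0 aE => // -[//|n] _ aE; apply: nPt; rewrite -st -aE -exprnP.
apply: (idealMl idP) => //; apply: (idealX idP); exact: ua.1.
Qed.

Lemma val_unique a b u v (m n : int) : uniformizer E P a -> uniformizer E P b ->
  locUnit E P u -> locUnit E P v -> a ^ m * u = b ^ n * v -> m = n.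
Proof.
move=> ua ub uu uv; have [w uw ->] := uniformizer_assoc ub ua.
have a0 := uniformizer_neq0 ua; have u0 := locUnit_neq0 uu.
rewrite exprzMl ?unitfE // ?(locUnit_neq0 uw) // -mulrA => mn.
have uwv : locUnit E P (w ^ n * v) by apply: locUnitM => //; exact: locUnit_exprz.
have mnE : a ^ (m - n) = (w ^ n * v) / u.
  by apply: (mulIf u0); rewrite divfK // expfzDr // -invr_expz mulrAC mn mulrC mulKf // expfz_neq0.
have [//|mn0] := eqVneq m n; exfalso.
have /orP[lt|lt] : (0 < m - n)%R || (0 < n - m)%R by lia.
  by apply: (nP_exprz ua _ lt mnE); apply: locUnitM => //; exact: locUnitV.
apply: (nP_exprz (u := u / (w ^ n * v)) ua _ lt); first by apply: locUnitM => //; exact: locUnitV.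
by rewrite -opprB -invr_expz mnE invf_div.
Qed.
End Local.
End Valuation.

Section ValuationTheory.
Variable W : splittingFieldType rat.
Implicit Types (E K : {subfield W}) (P Q I : set W).
Local Notation OO := ringOfIntegers.

Section Local.
Variables (E : {subfield W}) (P : set W) (p : nat).
Hypotheses (galE : galois 1%AS E) (maxP : isMaxIdeal E P) (pp : prime p) (Pp : P p%:R).
Let idP := max_ideal maxP.
Local Notation U x := (OO E x /\ ~ P x).
Local Notation v := (val E P).
Local Notation vg := (vge E P).

Lemma val_eq a u n : uniformizer E P a -> locUnit E P u -> v (a ^ n * u) = n.
Proof.
move=> ua uu; rewrite /val; case: xgetP => [m _ [b [w [ub uw eq]]]|/(_ n) []].
  exact: (val_unique maxP pp Pp ub ua uw uu (esym eq)).
by exists a, u.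
Qed.

(** n is the largest exponent such that a^n divides x locally. Such exponents are bounded by i e: x
    divides an integer m = m' p^e with m' prime to p, and p divides a^i t for some t outside P. *)
Lemma val_exists_int a x : uniformizer E P a -> OO E x -> x != 0 ->
  exists n : int, exists2 u, locUnit E P u & x = a ^ n * u.
Proof.
move=> ua Ox x0; have a0 := uniformizer_neq0 maxP pp Pp ua; have Oa := uniformizer_O maxP ua.
pose I := [set p%:R * x | x in OO E].
have idI : isIdeal E I by apply/ideal_principal/OO_nat.
have Ip : I p%:R by exists 1; rewrite ?mulr1 //; exact: OO1.
have [i [t [Ot nPt [c Oc pc]]]] := exists_cycle pp idI Ip idP (max_proper maxP) ua.1.
have [m [y [m_gt0 Oy xy]]] := max_nat_multiple galE Ox x0.
have [m' npm mE] := pfactor_coprime pp m_gt0.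
have nPm' : ~ P m'%:R.
  by move=> /(max_nat maxP pp Pp); apply/negP; rewrite -prime_coprime.
pose Q n := `[< exists s b, [/\ OO E s, ~ P s, OO E b & s * x = a ^+ n * b] >].
have Q0 : exists n, Q n.
  exists 0%N; apply/asboolP; exists 1, x; split=> //; first exact: OO1.
  exact: max_proper maxP.
pose N := (i * logn p m)%N.
have Qle n : Q n -> (n <= N)%N.
  move=> /asboolP[s [b [Os nPs Ob sx]]]; rewrite leqNgt; apply/negP => ltn.
  set e := logn p m in mE N ltn.
  have Pbad : P (s * m'%:R * t ^+ e).
    suff -> : s * m'%:R * t ^+ e = a ^+ (n - N).-1.+1 * (b * y * c ^+ e).
      by apply: (idealMr idP); [exact: (idealX idP _ ua.1) | apply: OOM; [exact: OOM | exact: OOX]].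
    apply: (mulfI (expf_neq0 N a0)); rewrite prednK ?subn_gt0 // !mulrA -exprD subnKC 1?ltnW //.
    rewrite -sx.
    transitivity (s * m'%:R * (a ^+ i * t) ^+ e); first by rewrite exprMn -exprM /N; ring.
    rewrite -pc exprMn -natrX (_ : s * x * y = s * (x * y)); last by ring.
    by rewrite xy mE natrM; ring.
  have [_] := nPM maxP (nPM maxP (conj Os nPs) (conj (OO_nat E m') nPm')) (nPX maxP e (conj Ot nPt)).
  by apply.
case: (ex_maxnP Q0 Qle) => n /asboolP[s [b [Os nPs Ob sx]]] maxn.
have s0 := nP_neq0 maxP nPs.
exists n, (b / s); last by apply: (mulfI s0); rewrite sx -exprnP mulrCA [s * _]mulrC divfK.
exists s, b; split=> //; last by rewrite mulrC divfK.
split=> // Pb; have [s' [c' [Os' nPs' Oc' sb]]] := ua.2 _ Pb.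
suff /maxn : Q n.+1 by rewrite ltnn.
apply/asboolP; exists (s' * s), c'.
have [? ?] := nPM maxP (conj Os' nPs') (conj Os nPs); split=> //.
by rewrite -mulrA sx mulrCA sb exprSr; ring.
Qed.

Lemma val_spec a x : uniformizer E P a -> x \in E -> x != 0 ->
  exists2 u, locUnit E P u & x = a ^ (v x) * u.
Proof.
move=> ua xE x0; have a0 := uniformizer_neq0 maxP pp Pp ua.
have [m m0 Omx] := OO_nat_denom xE.
have mW0 : m%:~R != 0 :> W by rewrite intrW_eq0.
have [n [u uu nE]] := val_exists_int ua Omx (mulf_neq0 mW0 x0).
have [n' [u' uu' nE']] := val_exists_int ua (OO_int E m) mW0.
have xE' : x = a ^ (n - n') * (u / u').
  apply: (mulfI mW0); rewrite nE {1}nE' expfzDr // -invr_expz.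
  rewrite (_ : _ * _ * (_ * _) = a ^ n * u * (a ^ n' / a ^ n') * (u' / u')); last by ring.
  by rewrite !divff ?mulr1 ?expfz_neq0 // (locUnit_neq0 maxP uu').
have uuu : locUnit E P (u / u') by apply: (locUnitM maxP) => //; exact: (locUnitV maxP).
by exists (u / u') => //; rewrite {1}xE' xE' val_eq.
Qed.

Lemma valM x y : x \in E -> y \in E -> x != 0 -> y != 0 -> v (x * y) = v x + v y.
Proof.
move=> xE yE x0 y0; have [a ua] := exists_uniformizer maxP pp Pp.
have a0 := uniformizer_neq0 maxP pp Pp ua.
have [u uu {1}->] := val_spec ua xE x0; have [w uw {1}->] := val_spec ua yE y0.
rewrite mulrACA -expfzDr // val_eq //; exact: (locUnitM maxP).
Qed.

Lemma val_locUnit u : locUnit E P u -> v u = 0.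
Proof.
have [a ua] := exists_uniformizer maxP pp Pp.
by move=> uu; rewrite -[u]mul1r -(expr0z a) val_eq.
Qed.

Lemma val_nP x : OO E x -> ~ P x -> v x = 0.
Proof. by move=> Ox nPx; apply/val_locUnit/(locUnit_nP maxP). Qed.

Lemma val1 : v 1 = 0. Proof. by apply: val_nP; [exact: OO1 | exact: max_proper maxP]. Qed.

Lemma valV x : x \in E -> x != 0 -> v x^-1 = - v x.
Proof.
move=> xE x0; apply/eqP; rewrite -addr_eq0 addrC; apply/eqP.
by rewrite -valM ?rpredV ?invr_eq0 // divff // val1.
Qed.

Lemma valX x n : x \in E -> x != 0 -> v (x ^+ n) = v x *+ n.
Proof.
move=> xE x0; elim: n => [|n IH]; first exact: val1.
by rewrite exprS mulrS valM ?rpredX ?expf_neq0 // IH.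
Qed.

Lemma val_uniformizer a : uniformizer E P a -> v a = 1.
Proof.
by move=> ua; rewrite -[a]mulr1 -[a]expr1z val_eq //; apply/(locUnit_nP maxP)/(nP1 maxP).
Qed.

Lemma locIntM x y : locInt E P x -> locInt E P y -> locInt E P (x * y).
Proof.
move=> [s [Os nPs Osx]] [t [Ot nPt Oty]]; exists (s * t).
have [? ?] := nPM maxP (conj Os nPs) (conj Ot nPt); split=> //.
by rewrite mulrACA; exact: OOM.
Qed.

Lemma locIntD x y : locInt E P x -> locInt E P y -> locInt E P (x + y).
Proof.
move=> [s [Os nPs Osx]] [t [Ot nPt Oty]]; exists (s * t).
have [? ?] := nPM maxP (conj Os nPs) (conj Ot nPt); split=> //.
rewrite (_ : _ * _ = t * (s * x) + s * (t * y)); last by ring.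
by apply: OOD; exact: OOM.
Qed.

Lemma locInt_OO x : OO E x -> locInt E P x.
Proof. by move=> Ox; exists 1; rewrite mul1r; split=> //; [exact: OO1 | exact: max_proper maxP]. Qed.

(** Dividing by a^n turns a bound on valuations into membership in the local ring, so that the
    ultrametric inequality [vgeD] becomes closure under addition. *)
Lemma vgeP a x n : uniformizer E P a -> x \in E -> vg n x <-> locInt E P (a ^ (- n) * x).
Proof.
move=> ua xE; have a0 := uniformizer_neq0 maxP pp Pp ua.
have [->|x0] := eqVneq x 0.
  rewrite mulr0; split=> _; first exact/locInt_OO/OO0.
  by split; [exact: rpred0 | left].
have [u [s [t [[Os nPs] [Ot nPt] su]]] xu] := val_spec ua xE x0.
have uE : u \in E by apply: (locUnit_mem maxP); exists s, t.
set m := v x in xu; split=> [[_ [/eqP|]]|[s' [Os' nPs' Ox]]].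
- by rewrite (negPf x0).
- rewrite -/m => lemn; exists s; split=> //.
  rewrite xu mulrA -expfzDr // mulrCA su; apply: OOM => //.
  have -> : - n + m = (`|(m - n)%R|%N : int) by lia.
  by apply: OOX; exact: uniformizer_O ua.
split=> //; right; rewrite -/m leNgt; apply/negP => ltmn.
have [_] := nPM maxP (conj Os' nPs') (conj Ot nPt); apply.
have -> : s' * t = a ^+ (`|(n - m)%R|%N.-1.+1) * (s * (s' * (a ^ (- n) * x))).
  have -> : a ^+ (`|(n - m)%R|%N.-1.+1) = a ^ (n - m).
    by rewrite exprnP; congr (_ ^ _); lia.
  have mulE A B C : A * (s * (s' * (B * (C * u)))) = s' * (s * u) * (A * B * C) by ring.
  rewrite xu mulE -su.
  by rewrite -!expfzDr // (_ : n - m - n + m = 0) ?expr0z ?mulr1 //; lia.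
apply: (idealMr idP); last exact: OOM.
exact: (idealX idP _ ua.1).
Qed.

Lemma vge_mem n x : vg n x -> x \in E. Proof. by case. Qed.
Lemma vge0 n : vg n 0. Proof. by split; [exact: rpred0 | left]. Qed.

Lemma vgeD n x y : vg n x -> vg n y -> vg n (x + y).
Proof.
have [a ua] := exists_uniformizer maxP pp Pp.
move=> gx gy; have xE := vge_mem gx; have yE := vge_mem gy.
apply/(vgeP _ ua); first exact: rpredD.
by rewrite mulrDr; apply: locIntD; apply/(vgeP _ ua).
Qed.

Lemma vgeM m n x y : vg m x -> vg n y -> vg (m + n) (x * y).
Proof.
have [a ua] := exists_uniformizer maxP pp Pp.
have a0 := uniformizer_neq0 maxP pp Pp ua.
move=> gx gy; have xE := vge_mem gx; have yE := vge_mem gy.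
apply/(vgeP _ ua); first exact: rpredM.
by rewrite opprD expfzDr // mulrACA; apply: locIntM; apply/(vgeP _ ua).
Qed.

Lemma vge_OO x : OO E x -> vg 0 x.
Proof.
have [a ua] := exists_uniformizer maxP pp Pp.
by move=> Ox; apply/(vgeP _ ua); [case: Ox | rewrite oppr0 expr0z mul1r; exact: locInt_OO].
Qed.

Lemma vgeMl n a x : OO E a -> vg n x -> vg n (a * x).
Proof. by move=> /vge_OO ga gx; rewrite -[n]add0r; exact: vgeM. Qed.

Lemma vgeN n x : vg n x -> vg n (- x).
Proof. by rewrite -mulN1r; apply: vgeMl; apply/OON/OO1. Qed.

Lemma vgeB n x y : vg n x -> vg n y -> vg n (x - y).
Proof. by move=> gx gy; apply: vgeD => //; exact: vgeN. Qed.

Lemma vge_sum n (T : Type) (r : seq T) (S : pred T) (f : T -> W) :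
  (forall i, S i -> vg n (f i)) -> vg n (\sum_(i <- r | S i) f i).
Proof. by move=> h; elim/big_ind: _ => //; [exact: vge0 | exact: vgeD]. Qed.

Lemma vge_le m n x : (m <= n)%R -> vg n x -> vg m x.
Proof. by move=> lemn [xE [->|lex]]; [exact: vge0 | split=> //; right; exact: le_trans lex]. Qed.

Lemma vgeX n x k : vg n x -> vg (n *+ k) (x ^+ k).
Proof.
move=> gx; elim: k => [|k IH]; first exact/vge_OO/OO1.
by rewrite exprS mulrS; exact: vgeM.
Qed.

Lemma vge_val x : x \in E -> vg (v x) x. Proof. by split=> //; right. Qed.

Lemma vge_neq0 n x : x != 0 -> vg n x -> (n <= v x)%R.
Proof. by move=> /eqP x0 [_ []]. Qed.

Lemma vge1P x : OO E x -> P x <-> vg 1 x.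
Proof.
move=> Ox; have xE : x \in E by case: Ox.
have [a ua] := exists_uniformizer maxP pp Pp; split=> [Px|].
  have [s [c [Os nPs Oc sx]]] := ua.2 _ Px; apply/(vgeP _ ua) => //.
  exists s; split=> //; rewrite mulrCA sx -invr_expz expr1z mulKf //.
  exact: (uniformizer_neq0 maxP pp Pp ua).
move=> gx; apply: contrapT => nPx.
by have := vge_neq0 (nP_neq0 maxP nPx) gx; rewrite val_nP.
Qed.

Lemma val_addl x y n : x != 0 -> (v x < n)%R -> x \in E -> vg n y ->
  x + y != 0 /\ v (x + y) = v x.
Proof.
move=> x0 ltn xE gy; have yE := vge_mem gy.
have nz : x + y != 0.
  apply/negP; rewrite addr_eq0 => /eqP xy.
  have : vg n x by rewrite xy; exact: vgeN.
  by move/(vge_neq0 x0); rewrite leNgt ltn.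
split=> //; apply/eqP; rewrite eq_le; apply/andP; split.
  rewrite leNgt; apply/negP => lt.
  have : vg (v x + 1) x.
    rewrite -[x in vg _ x](addrK y); apply: vgeB; last by apply: vge_le gy; lia.
    apply: (@vge_le _ (v (x + y))); first by lia.
    by apply: vge_val; exact: rpredD.
  by move/(vge_neq0 x0); lia.
apply: vge_neq0 => //; apply: vgeD; first exact: vge_val.
by apply: vge_le gy; exact: ltW.
Qed.

End Local.
End ValuationTheory.

(** * Galois-stable ideals above a prime *)

Section MulIdeal.
Variable W : fieldExtType rat.
Implicit Types (E F : {subfield W}) (I J S : set W) (x y : W).
Local Notation OO := ringOfIntegers.

Lemma mulIdeal0 I J : mulIdeal I J 0.
Proof. by exists 0%N, (fun=> 0), (fun=> 0); split=> [[]//|[]//|]; rewrite big_ord0. Qed.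

Lemma mulIdeal_prod I J x y : I x -> J y -> mulIdeal I J (x * y).
Proof. by move=> Ix Jy; exists 1%N, (fun=> x), (fun=> y); rewrite big_ord1. Qed.

Lemma mulIdealD I J x y : mulIdeal I J x -> mulIdeal I J y -> mulIdeal I J (x + y).
Proof.
move=> [m [f [g [If Jg ->]]]] [n [f' [g' [If' Jg' ->]]]].
exists (m + n)%N, (fun k : 'I_(m + n) => match fintype.split k with inl i => f i | inr j => f' j end),
  (fun k : 'I_(m + n) => match fintype.split k with inl i => g i | inr j => g' j end).
split=> [k|k|]; try by case: (fintype.split k).
rewrite big_split_ord /=; congr (_ + _); apply: eq_bigr => i _.
  by rewrite -[lshift n i]/(unsplit (inl i)) unsplitK.
by rewrite -[rshift m i]/(unsplit (inr i)) unsplitK.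
Qed.

Lemma mulIdeal_sub I J S : S 0 -> (forall x y, S x -> S y -> S (x + y)) ->
  (forall x y, I x -> J y -> S (x * y)) -> mulIdeal I J `<=` S.
Proof.
move=> S0 SD SM _ [n [f [g [If Jg ->]]]].
by elim/big_ind: _ => // i _; exact: SM.
Qed.

Lemma mulIdealMl I J a : (forall x, I x -> I (a * x)) ->
  forall x, mulIdeal I J x -> mulIdeal I J (a * x).
Proof.
move=> aI x; apply: (mulIdeal_sub (S := fun x => mulIdeal I J (a * x))) => [|y z Iy Iz|y z Iy Jz].
- by rewrite mulr0; exact: mulIdeal0.
- by rewrite mulrDr; exact: mulIdealD.
- by rewrite mulrA; apply: mulIdeal_prod => //; exact: aI.
Qed.

Lemma mulIdealC I J : mulIdeal I J = mulIdeal J I.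
Proof.
have sub (A B : set W) : mulIdeal A B `<=` mulIdeal B A.
  apply: (mulIdeal_sub (S := mulIdeal B A)) => [|x y|x y Ax By]; [exact: mulIdeal0 | exact: mulIdealD |].
  by rewrite mulrC; exact: mulIdeal_prod.
by apply/seteqP; split; exact: sub.
Qed.

Lemma OSubmodule_mulIdeal E I J : OSubmodule E I -> OSubmodule E (mulIdeal I J).
Proof.
move=> [I0 ID IM]; split=> [|x y|a x Oa]; [exact: mulIdeal0 | exact: mulIdealD |].
by apply: mulIdealMl => y; exact: IM.
Qed.

Lemma ideal_mulIdeal E I J : isIdeal E I -> isIdeal E J -> isIdeal E (mulIdeal I J).
Proof.
move=> idI idJ; split; first by apply: OSubmodule_mulIdeal; case: idI.
apply: (mulIdeal_sub (S := OO E)) => [|x y|x y Ix Jy]; [exact: OO0 | exact: OOD |].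
by apply: OOM; [exact: (ideal_sub idI) | exact: (ideal_sub idJ)].
Qed.

Lemma mulIdeal1 E I : OSubmodule E I -> mulIdeal I (OO E) = I.
Proof.
move=> [I0 ID IM]; apply/seteqP; split.
  by apply: (mulIdeal_sub (S := I)) => // x y Ix Oy; rewrite mulrC; exact: IM.
by move=> x Ix; rewrite -[x]mulr1; apply: mulIdeal_prod => //; exact: OO1.
Qed.

Lemma mulIdealZ I J a b : mulIdeal [set a * x | x in I] [set b * x | x in J] =
  [set a * b * x | x in mulIdeal I J].
Proof.
apply/seteqP; split.
  apply: (mulIdeal_sub (S := [set a * b * x | x in mulIdeal I J])) => [|_ _ [x Ix <-] [y Iy <-]|_ _ [x Ix <-] [y Jy <-]].
  - by exists 0; [exact: mulIdeal0 | rewrite mulr0].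
  - by exists (x + y); [exact: mulIdealD | rewrite mulrDr].
  - by exists (x * y); [exact: mulIdeal_prod | rewrite mulrACA].
move=> _ [x IJx <-]; move: x IJx.
apply: (mulIdeal_sub (S := fun x => mulIdeal _ _ (a * b * x))) => [|x y|x y Ix Jy].
- by rewrite mulr0; exact: mulIdeal0.
- by rewrite mulrDr; exact: mulIdealD.
- by rewrite mulrACA; apply: mulIdeal_prod; [exists x | exists y].
Qed.

Lemma ideal_ext E F I : (F <= E)%VS -> isIdeal F I -> isIdeal E (extIdeal E I).
Proof.
move=> sFE idI; rewrite /extIdeal mulIdealC; split.
  by apply: OSubmodule_mulIdeal; case: (idealO E).
apply: (mulIdeal_sub (S := OO E)) => [|x y|x y Ox Iy]; [exact: OO0 | exact: OOD |].
by apply: OOM => //; apply: (OO_sub sFE); exact: (ideal_sub idI).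
Qed.
End MulIdeal.

(** * Valuations under conjugation and under restriction to a subfield *)

Section Transport.
Variable W : splittingFieldType rat.
Implicit Types (E F K : {subfield W}) (P Q I : set W).
Local Notation OO := ringOfIntegers.

Lemma aend_stable K (f : 'AEnd(W)) x : galois 1%AS K -> x \in K -> f x \in K.
Proof.
case/and3P => s1K _ nK xK.
have /(_ f) : forall f, kAut 1 {:W} f -> kAut 1 K f.
  by move=> g; apply: (@normalField_kAut _ _ 1%AS K {:W}%AS); rewrite ?s1K ?subvf.
rewrite kAutfE k1AHom => /(_ isT)/andP[_ /eqP <-].
exact: memv_img.
Qed.

Section Conj.
Variables (E : {subfield W}) (s t : {rmorphism W -> W}).
Hypotheses (sE : forall x, x \in E -> s x \in E) (tE : forall x, x \in E -> t x \in E).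
Hypotheses (sK : {in E, cancel s t}) (tK : {in E, cancel t s}).

Lemma val_conj P p x : galois 1%AS E -> isMaxIdeal E P -> prime p -> P p%:R ->
  x \in E -> x != 0 -> val E (s @` P) (s x) = val E P x.
Proof.
move=> galE maxP pp Pp xE x0; have idP := max_ideal maxP.
have maxQ := max_conj sE tE sK tK maxP.
have Qp : (s @` P) p%:R by exists p%:R => //; exact: rmorph_nat.
have [a ua] := exists_uniformizer maxP pp Pp.
have sU y : OO E y /\ ~ P y -> OO E (s y) /\ ~ (s @` P) (s y).
  move=> [Oy nPy]; split; first exact: (OO_conj sE).
  by case/(conjP sE sK tK _ idP) => _; rewrite sK //; case: Oy.
have usa : uniformizer E (s @` P) (s a).
  split=> [|_ [b Pb <-]]; first by exists a => //; exact: ua.1.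
  have [z [c [Oz nPz Oc zb]]] := ua.2 _ Pb; exists (s z), (s c).
  by have [? ?] := sU z (conj Oz nPz); split=> //; [exact: OO_rmorph Oc | rewrite -!rmorphM zb].
have [u [y [z [Uy Uz yu]]] {1}->] := val_spec galE maxP pp Pp ua xE x0.
rewrite rmorphM fmorphXz; apply: (val_eq maxQ pp Qp _ usa).
by exists (s y), (s z); split; [exact: sU | exact: sU | rewrite -rmorphM yu].
Qed.
End Conj.

Lemma val_gal K (u : gal_of K) P p x : galois 1%AS K -> isMaxIdeal K P -> prime p ->
  P p%:R -> x \in K -> x != 0 -> val K (u @` P) (u x) = val K P x.
Proof.
have um (v : gal_of K) y : y \in K -> v y \in K by apply: memv_gal.
exact: (@val_conj K (gal_repr u) (gal_repr (u^-1)%g) (um u) (um _) (@gal_cancel _ _ u) (@gal_cancelV _ _ u)).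
Qed.

(** e is the valuation in E of a uniformizer of F at the prime below P; conjugacy makes it the same
    at all primes above p. This e serves as the ramification index in all that follows, while
    [ramIndex] enters only through [tame_val]. *)
Lemma val_restrict E F p : galois 1%AS E -> galois 1%AS F -> (F <= E)%VS -> prime p ->
  exists e : nat, (0 < e)%N /\ forall P, isMaxIdeal E P -> P p%:R ->
    forall x, x \in F -> x != 0 -> val E P x = val F (P `&` OO F) x * e.
Proof.
move=> galE galF sFE pp.
have [[P [maxP Pp]]|nP] := pselect (exists P, isMaxIdeal E P /\ P p%:R); last first.
  by exists 1%N; split=> // P maxP Pp; case: nP; exists P.
have sFE' x : x \in F -> x \in E by move/subvP: sFE; apply.
have maxP1 := max_restrict sFE pp maxP Pp; set P1 := P `&` OO F in maxP1.
have P1p : P1 p%:R by split=> //; exact: OO_nat.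
have [a ua] := exists_uniformizer maxP1 pp P1p.
have [Pa Oa] := ua.1; have aE : a \in E by apply: sFE'; case: Oa.
have a0 := uniformizer_neq0 maxP1 pp P1p ua.
have OaE := OO_sub sFE Oa.
have e_gt0 : (1 <= val E P a)%R.
  by apply: vge_neq0 => //; apply/(vge1P galE maxP pp Pp).
have val_expz (b : W) (n : int) : b \in E -> b != 0 -> val E P (b ^ n) = n * val E P b.
  move=> bE b0; case: n => n.
    by rewrite -exprnP (valX galE maxP pp Pp) // -mulr_natl natz.
  rewrite NegzE -invr_expz -exprnP (valV galE maxP pp Pp) ?expf_neq0 ?rpredX //.
  by rewrite (valX galE maxP pp Pp) // mulNr -mulr_natl natz.
have eP x : x \in F -> x != 0 -> val E P x = val F P1 x * (`|val E P a|%N : int).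
  move=> xF x0; have [u [s [t [[Os nPs] [Ot nPt] su]]] xE] := val_spec galF maxP1 pp P1p ua xF x0.
  have uu : locUnit E P u.
    exists s, t; split=> //.
      by split; [exact: (OO_sub sFE) | move=> Ps; apply: nPs].
    by split; [exact: (OO_sub sFE) | move=> Pt; apply: nPt].
  have u0 := locUnit_neq0 maxP uu; have uE := locUnit_mem maxP uu.
  rewrite {1}xE (valM galE maxP pp Pp) ?expfz_neq0 //; last first.
    by case: (val F P1 x) => n; rewrite ?NegzE -?invr_expz -exprnP ?rpredV rpredX.
  by rewrite (val_locUnit maxP pp Pp uu) addr0 val_expz //; lia.
exists `|val E P a|%N; split; first by lia.
move=> Q maxQ Qp x xF x0; have [u QE] := max_transitive galE pp maxP maxQ Pp Qp.
have uVx : (u^-1)%g x \in F by apply: aend_stable.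
have uV0 : (u^-1)%g x != 0 by rewrite fmorph_eq0.
have ux : x = u ((u^-1)%g x) by rewrite gal_cancelV //; exact: sFE'.
have um (v : gal_of E) y : y \in F -> v y \in F by apply: aend_stable.
have uK : {in F, cancel u (u^-1)%g} by move=> y /sFE'/gal_cancel.
have uVK : {in F, cancel (u^-1)%g u} by move=> y /sFE'/gal_cancelV.
have <- : u @` P1 = Q `&` OO F.
  rewrite QE; apply/seteqP; split=> [_ [y [Py Oy] <-]|_ [[y Py <-] Oy]].
    by split; [exists y | apply: OO_rmorph Oy; exact: um].
  exists y => //; split=> //.
  have yE : y = (u^-1)%g (u y) by rewrite gal_cancel //; case: (ideal_sub (max_ideal maxP) Py).
  by rewrite yE; apply: OO_rmorph Oy; exact: um.
rewrite QE {1}ux (val_gal _ galE maxP pp Pp) ?sFE' // eP //.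
rewrite [in RHS]ux.
congr (_ * _); apply/esym.
exact: (@val_conj F (gal_repr u) (gal_repr (u^-1)%g) (um u) (um _) uK uVK P1 p).
Qed.
End Transport.

(** * Ideals with the same valuation at all primes above p *)

Section OrdIdeal.
Variable W : splittingFieldType rat.
Implicit Types (E F K : {subfield W}) (P Q I : set W).
Local Notation OO := ringOfIntegers.

Definition ordIdeal E (p n : nat) : set W :=
  [set x | OO E x /\ forall P, isMaxIdeal E P -> P p%:R -> vge E P n x].

Section Fixed.
Variables (E : {subfield W}) (p : nat).
Hypotheses (galE : galois 1%AS E) (pp : prime p).
Let p0 : p%:R != 0 :> W. Proof. by rewrite natrW_eq0 -lt0n prime_gt0. Qed.

Lemma ideal_ordIdeal n : isIdeal E (ordIdeal E p n).
Proof.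
split=> [|x []//]; split=> [|x y [Ox hx] [Oy hy]|a x Oa [Ox hx]].
- by split=> [|P _ _]; [exact: OO0 | exact: vge0].
- by split=> [|P maxP Pp]; [exact: OOD | apply: (vgeD galE maxP pp Pp); auto].
- by split=> [|P maxP Pp]; [exact: OOM | apply: (vgeMl galE maxP pp Pp); auto].
Qed.

(** This stands in for unique factorization. For x in the right-hand side, the ideal J of all s with
    s x in I is in no maximal ideal M: if M contains p, compare x with an element of I of valuation
    exactly n at M; if not, use the power of p in I. *)
Lemma ordIdealP I (k n : nat) : isIdeal E I -> I (p%:R ^+ k) ->
  (forall P, isMaxIdeal E P -> P p%:R -> forall x, I x -> vge E P n x) ->
  (forall P, isMaxIdeal E P -> P p%:R -> exists x, [/\ I x, x != 0 & val E P x = n]) ->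
  I = ordIdeal E p n.
Proof.
move=> idI Ipk geI exI; apply/seteqP; split=> [x Ix|x [Ox gex]].
  by split=> [|P maxP Pp]; [exact: ideal_sub Ix | exact: geI].
pose J := [set s | OO E s /\ I (s * x)].
have idJ : isIdeal E J.
  split=> [|s []//]; split=> [|s t [Os Is] [Ot It]|a s Oa [Os Is]].
  - by split; [exact: OO0 | rewrite mul0r; exact: ideal0 idI].
  - by split; [exact: OOD | rewrite mulrDl; exact: (idealD idI)].
  - by split; [exact: OOM | rewrite -mulrA; exact: (idealMl idI)].
have [[_]|nJ1] := pselect (J 1); first by rewrite mul1r.
have [M maxM JM] := exists_max idJ nJ1; exfalso.
have [Mp|nMp] := pselect (M p%:R).
  have [y [Iy y0 vy]] := exI M maxM Mp.
  have [[yE _] xE] : OO E y /\ x \in E by split; [exact: ideal_sub Iy | case: Ox].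
  have : vge E M 0 (x / y).
    rewrite -(subrr (n : int)); apply: (vgeM galE maxM pp Mp); first exact: gex.
    by split; rewrite ?rpredV //; right; rewrite (valV galE maxM pp Mp) // vy.
  have [a ua] := exists_uniformizer maxM pp Mp.
  move/(vgeP galE maxM pp Mp _ ua); rewrite oppr0 expr0z mul1r => /(_ (rpred_div xE yE)).
  move=> [s [Os nMs Osxy]]; apply/nMs/JM; split=> //.
  have -> : s * x = s * (x / y) * y by rewrite mulrA divfK.
  exact: (idealMl idI).
apply: nMp; apply: (max_primeX maxM (OO_nat E p) (n := k)); apply: JM.
by split; [exact/OOX/OO_nat | rewrite mulrC; exact: (idealMl idI)].
Qed.

Lemma exists_finite_list : exists s : seq (set W),
  uniq s /\ forall P, P \in s <-> isMaxIdeal E P /\ P p%:R.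
Proof.
pose S := [set P : set W | isMaxIdeal E P /\ P p%:R].
have finS : finite_set S by exact: max_finite.
exists (fset_set S); split=> [|P]; first exact: fset_uniq.
by rewrite in_fset_set // inE.
Qed.

(** A uniformizer at P is multiplied by an integer that lies outside P and in all other primes above
    p. *)
Lemma exists_val1 P : isMaxIdeal E P -> P p%:R ->
  exists a, [/\ ordIdeal E p 1 a, a != 0 & val E P a = 1].
Proof.
move=> maxP Pp; have [s [us sP]] := exists_finite_list.
have maxs Q : Q \in rem P s -> isMaxIdeal E Q by move=> /mem_rem/sP[].
have Ps : P \notin rem P s by rewrite mem_rem_uniq // inE eqxx.
have [y [Oy nPy yQ]] := max_separate maxP maxs Ps.
have [a ua] := exists_uniformizer maxP pp Pp.
have Oa := uniformizer_O maxP ua; have a0 := uniformizer_neq0 maxP pp Pp ua.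
have y0 := nP_neq0 maxP nPy; have Oay : OO E (a * y) by exact: OOM.
exists (a * y); split; last first.
- rewrite (valM galE maxP pp Pp) //; [|by case: Oa|by case: Oy].
  by rewrite (val_uniformizer maxP pp Pp ua) (val_nP maxP pp Pp) // addr0.
- by rewrite mulf_neq0.
split=> // Q maxQ Qp; apply/(vge1P galE maxQ pp Qp) => //.
have [->|neq] := eqVneq Q P; first by apply: (idealMr (max_ideal maxP)) => //; exact: ua.1.
apply: (idealMl (max_ideal maxQ)) => //; apply: yQ.
by rewrite mem_rem_uniq // inE neq /=; apply/sP.
Qed.

Lemma ordIdeal_natX n : ordIdeal E p n (p%:R ^+ n).
Proof.
split=> [|P maxP Pp]; first exact/OOX/OO_nat.
rewrite -[n in vge _ _ n](natz n); apply: (vgeX galE maxP pp Pp).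
by apply/(vge1P galE maxP pp Pp) => //; exact: OO_nat.
Qed.

Lemma ordIdeal_exists_val P (n : nat) : isMaxIdeal E P -> P p%:R ->
  exists a, [/\ ordIdeal E p n a, a != 0 & val E P a = n].
Proof.
move=> maxP Pp; have [a [[Oa ge1] a0 va]] := exists_val1 maxP Pp.
exists (a ^+ n); rewrite expf_neq0 //; split=> //.
  split=> [|Q maxQ Qp]; first exact: OOX.
  rewrite -[n in vge _ _ n](natz n); apply: (vgeX galE maxQ pp Qp); exact: ge1.
by rewrite (valX galE maxP pp Pp) //; [rewrite va natz | case: Oa].
Qed.

Lemma ordIdealM m n : mulIdeal (ordIdeal E p m) (ordIdeal E p n) = ordIdeal E p (m + n).
Proof.
apply: (ordIdealP (k := m + n)).
- by apply: ideal_mulIdeal; exact: ideal_ordIdeal.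
- by rewrite exprD; apply: mulIdeal_prod; exact: ordIdeal_natX.
- move=> P maxP Pp; apply: (mulIdeal_sub (S := vge E P (m + n)%N)) => [|x y|x y [_ gx] [_ gy]].
  + exact: vge0.
  + exact: (vgeD galE maxP pp Pp).
  + by rewrite PoszD; apply: (vgeM galE maxP pp Pp); auto.
move=> P maxP Pp; have [a [Ia a0 va]] := ordIdeal_exists_val m maxP Pp.
have [b [Ib b0 vb]] := ordIdeal_exists_val n maxP Pp; exists (a * b); split.
- exact: mulIdeal_prod.
- exact: mulf_neq0.
- rewrite (valM galE maxP pp Pp) ?va ?vb //.
    by case: Ia => -[].
  by case: Ib => -[].
Qed.

Lemma ordIdeal0 : ordIdeal E p 0 = OO E.
Proof.
apply/esym/(ordIdealP (k := 0)).
- exact: idealO.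
- exact: OO1.
- by move=> P maxP Pp x; exact: (vge_OO galE maxP pp Pp).
move=> P maxP Pp; exists 1; rewrite oner_neq0 (val1 maxP pp Pp); split=> //; exact: OO1.
Qed.

(** The absolute ramification index of p appears as e; it makes a positive power of the class of
    [ordIdeal E p 1] trivial. *)
Lemma principal_ordIdeal : exists2 e, (0 < e)%N &
  [set p%:R * x | x in OO E] = ordIdeal E p e.
Proof.
have [[P [maxP Pp]]|nP] := pselect (exists P, isMaxIdeal E P /\ P p%:R); last first.
  exists 1%N => //; apply: (ordIdealP (k := 1)).
  - exact/ideal_principal/OO_nat.
  - by exists 1; rewrite ?mulr1 //; exact: OO1.
  - by move=> P maxP Pp; case: nP; exists P.
  - by move=> P maxP Pp; case: nP; exists P.
have v1 : (1 <= val E P p%:R)%R.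
  by apply: vge_neq0 => //; apply/(vge1P galE maxP pp Pp) => //; exact: OO_nat.
exists `|val E P p%:R|%N; first by lia.
have eP Q : isMaxIdeal E Q -> Q p%:R -> val E Q p%:R = (`|val E P p%:R|%N : int).
  move=> maxQ Qp; have [u QE] := max_transitive galE pp maxP maxQ Pp Qp.
  rewrite QE -{1}(rmorph_nat (gal_repr u)) (val_gal _ galE maxP pp Pp (rpred_nat _ _) p0).
  by rewrite gez0_abs // (le_trans _ v1).
apply: (ordIdealP (k := 1)).
- exact/ideal_principal/OO_nat.
- by exists 1; rewrite ?mulr1 //; exact: OO1.
- move=> Q maxQ Qp _ [x Ox <-]; rewrite mulrC; apply: (vgeMl galE maxQ pp Qp) => //.
  by rewrite -(eP Q) //; apply: vge_val; exact: rpred_nat.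
move=> Q maxQ Qp; exists p%:R; rewrite p0 eP //; split=> //.
by exists 1; rewrite ?mulr1 //; exact: OO1.
Qed.

Lemma bigmul_ordIdeal (s : seq (set W)) : uniq s ->
  (forall P, P \in s -> isMaxIdeal E P /\ P p%:R) ->
  let I := \big[@mulIdeal W/OO E]_(P <- s) P in
  [/\ isIdeal E I, I (p%:R ^+ size s),
    forall P, P \in s -> forall x, I x -> vge E P 1 x
  & forall P, isMaxIdeal E P -> P p%:R ->
      exists x, [/\ I x, x != 0 & val E P x = (P \in s)%:R]].
Proof.
elim: s => [|Q s IH] /=.
  move=> _ _; rewrite big_nil; split=> //; [exact: idealO | exact: OO1 |].
  move=> P maxP Pp; exists 1; rewrite oner_neq0 (val1 maxP pp Pp); split=> //; exact: OO1.
move=> /andP[Qs us] maxs; rewrite big_cons.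
have [maxQ Qp] : isMaxIdeal E Q /\ Q p%:R by apply: maxs; rewrite mem_head.
have idQ := max_ideal maxQ.
have [|idI Ips gI exI] := IH us; first by move=> P Ps; apply: maxs; rewrite inE Ps orbT.
set I := \big[_/_]_(_ <- _) _ in idI Ips gI exI *.
have idQI := ideal_mulIdeal idQ idI; split=> //.
- by rewrite exprS; exact: mulIdeal_prod.
- move=> P; rewrite inE => Ps.
  have [maxP Pp] : isMaxIdeal E P /\ P p%:R by apply: maxs; rewrite inE.
  apply: (mulIdeal_sub (S := vge E P 1)) => [|x y|x y Qx Iy].
  + exact: vge0.
  + exact: (vgeD galE maxP pp Pp).
  move/predU1P: Ps => [PQ|Ps].
    rewrite mulrC; apply: (vgeMl galE maxP pp Pp); first exact: (ideal_sub idI).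
    by rewrite PQ; apply/(vge1P galE maxQ pp Qp) => //; exact: (ideal_sub idQ).
  by apply: (vgeMl galE maxP pp Pp); [exact: (ideal_sub idQ) | exact: gI].
move=> P maxP Pp; have [x [Ix x0 vx]] := exI P maxP Pp.
have xE : x \in E by case: (ideal_sub idI Ix).
have [PQ|/eqP neq] := eqVneq P Q.
  have [a ua] := exists_uniformizer maxP pp Pp.
  have a0 := uniformizer_neq0 maxP pp Pp ua.
  exists (a * x); split; [|exact: mulf_neq0|].
    by apply: mulIdeal_prod => //; rewrite -PQ; exact: ua.1.
  rewrite (valM galE maxP pp Pp) ?(uniformizer_mem maxP ua) //.
  by rewrite (val_uniformizer maxP pp Pp ua) vx inE PQ eqxx (negPf Qs) addr0.
have [z Qz nPz] := max_neq maxQ maxP (nesym neq); have Oz := ideal_sub idQ Qz.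
have z0 := nP_neq0 maxP nPz.
exists (z * x); split; [exact: mulIdeal_prod | exact: mulf_neq0 |].
rewrite (valM galE maxP pp Pp) //; last by case: Oz.
by rewrite (val_nP maxP pp Pp) // vx add0r inE; move/eqP/negPf: neq => ->.
Qed.

(** The norm q is a power of p, so every maximal ideal of norm q lies above p; conversely the primes
    above p are conjugate to P, so they have the same norm. *)
Lemma PiIdeal_ordIdeal P q : isMaxIdeal E P -> P p%:R -> hasNorm E P q ->
  PiIdeal E q = ordIdeal E p 1.
Proof.
move=> maxP Pp Pq; rewrite /PiIdeal.
set S := [set _ | _]; have SE : S = [set P | isMaxIdeal E P /\ P p%:R].
  apply/seteqP; split=> Q /= [maxQ hQ]; split=> //; last first.
    exact: hasNorm_transitive galE pp maxP maxQ Pp hQ Pq.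
  have [l lp Ql] := max_over_prime galE maxQ.
  have [k [k0 Pk]] := max_hasNorm pp maxP Pp; have [k' [k'0 Qk']] := max_hasNorm lp maxQ Ql.
  have : (p %| l ^ k')%N.
    by rewrite (hasNorm_inj Qk' hQ) (hasNorm_inj Pq Pk) dvdn_exp.
  by rewrite Euclid_dvdX // dvdn_prime2 // => /andP[/eqP -> _].
have finS : finite_set S by rewrite SE; exact: max_finite.
have memS Q : Q \in fset_set S <-> isMaxIdeal E Q /\ Q p%:R.
  by rewrite in_fset_set // inE SE.
have [idI Ip gI exI] := bigmul_ordIdeal (fset_uniq (fset_set S)) (fun Q => (memS Q).1).
apply: (ordIdealP idI Ip) => Q maxQ Qp; first exact/gI/memS.
have [x [Ix x0 vx]] := exI Q maxQ Qp; exists x; split=> //.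
by rewrite vx (_ : Q \in _ = true) //; apply/memS.
Qed.
End Fixed.

Lemma ext_ordIdeal E F p : galois 1%AS E -> galois 1%AS F -> (F <= E)%VS -> prime p ->
  forall e : nat, (0 < e)%N -> (forall P, isMaxIdeal E P -> P p%:R ->
    forall x, x \in F -> x != 0 -> val E P x = val F (P `&` OO F) x * e) ->
  extIdeal E (ordIdeal F p 1) = ordIdeal E p e.
Proof.
move=> galE galF sFE pp e e_gt0 eP.
have sFE' x : x \in F -> x \in E by move/subvP: sFE; apply.
apply: (ordIdealP galE pp (k := 1)).
- by apply: (ideal_ext sFE); exact: ideal_ordIdeal.
- by rewrite -[_ ^+ 1]mulr1; apply: mulIdeal_prod; [exact: ordIdeal_natX | exact: OO1].
- move=> P maxP Pp; apply: (mulIdeal_sub (S := vge E P e)) => [|x y|x y [[xF ix] gx] Oy].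
  + exact: vge0.
  + exact: (vgeD galE maxP pp Pp).
  rewrite mulrC; apply: (vgeMl galE maxP pp Pp) => //; split; first exact: sFE'.
  have [->|x0] := eqVneq x 0; [by left | right].
  have P1p : (P `&` OO F) p%:R by split=> //; exact: OO_nat.
  have := vge_neq0 x0 (gx _ (max_restrict sFE pp maxP Pp) P1p).
  by rewrite eP // => h; rewrite -[X in (X <= _)%R]mul1r ler_wpM2r.
move=> P maxP Pp; have P1p : (P `&` OO F) p%:R by split=> //; exact: OO_nat.
have [a [Ia a0 va]] := exists_val1 galF pp (max_restrict sFE pp maxP Pp) P1p.
exists a; split=> //; first by rewrite -[a]mulr1; apply: mulIdeal_prod => //; exact: OO1.
by rewrite eP // ?va ?mul1r //; case: Ia => -[].
Qed.
End OrdIdeal.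

Lemma exprD1n_prime (R : comNzRingType) (x : R) p : prime p ->
  exists m : nat -> nat,
    (1 + x) ^+ p = 1 + p%:R * (\sum_(i < p.-1) (m i)%:R * x ^+ i.+1) + x ^+ p.
Proof.
move=> pp; exists (fun i => 'C(p, i.+1) %/ p)%N.
case: p pp => [|[|q]] // pp; rewrite exprDn big_ord_recl big_ord_recr /=.
rewrite subn0 expr1n expr0 bin0 mulr1 mulr1n.
rewrite /bump /= add1n subnn expr0 mul1r binn mulr1n addrA; congr (_ + _ + _).
rewrite mulr_sumr; apply: eq_bigr => i _.
rewrite add1n expr1n mul1r -mulr_natl mulrA -natrM mulnC divnK //.
by apply: prime_dvd_bin => //; have := ltn_ord i; lia.
Qed.

(** * Inertia and tame ramification *)

Section OneUnits.
Variable W : splittingFieldType rat.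
Local Notation OO := ringOfIntegers.
Variables (E : {subfield W}) (P : set W) (p : nat).
Hypotheses (galE : galois 1%AS E) (maxP : isMaxIdeal E P) (pp : prime p) (Pp : P p%:R).
Local Notation v := (val E P).
Local Notation vg := (vge E P).

Let vgD n x y : vg n x -> vg n y -> vg n (x + y). Proof. exact: (vgeD galE maxP pp Pp). Qed.
Let vgB n x y : vg n x -> vg n y -> vg n (x - y). Proof. exact: (vgeB galE maxP pp Pp). Qed.
Let vgMl n a x : OO E a -> vg n x -> vg n (a * x). Proof. exact: (vgeMl galE maxP pp Pp). Qed.

Lemma vgeM0 n a x : vg 0 a -> vg n x -> vg n (a * x).
Proof. by move=> ga gx; rewrite -[n]add0r; exact: (vgeM galE maxP pp Pp). Qed.

Lemma vge_p : vg 1 p%:R.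
Proof. by apply/(vge1P galE maxP pp Pp) => //; exact: OO_nat. Qed.

Lemma val_nat_coprime n : ~~ (p %| n)%N -> v n%:R = 0.
Proof.
move=> npn; apply: (val_nP maxP pp Pp); first exact: OO_nat.
by move=> /(max_nat maxP pp Pp); exact/negP.
Qed.

Lemma vge_mulrn_inv n k x : x \in E -> ~~ (p %| k)%N -> vg n (x *+ k) -> vg n x.
Proof.
move=> xE npk; have [->|x0] := eqVneq x 0; first by move=> _; exact: vge0.
have k0 : k%:R != 0 :> W by rewrite natrW_eq0; apply: contraNneq npk => ->.
rewrite -mulr_natl => /(vge_neq0 (mulf_neq0 k0 x0)).
rewrite (valM galE maxP pp Pp) ?rpred_nat // val_nat_coprime // add0r => le.
by split=> //; right.
Qed.

(** Injectivity of Frobenius on the residue field: for c = 1 + x, c^p - 1 is x^p up to a multiple of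
    p. *)
Lemma vge1_root c : vg 0 (c - 1) -> vg 1 (c ^+ p - 1) -> vg 1 (c - 1).
Proof.
set x := c - 1; have -> : c = 1 + x by rewrite /x addrC subrK.
move=> gx; have xE := vge_mem gx; have [m ->] := exprD1n_prime x pp.
set S := \sum_(i < _) _ => g1; have gS : vg 1 (p%:R * S).
  rewrite -[1]addr0; apply: (vgeM galE maxP pp Pp); first exact: vge_p.
  apply: (vge_sum galE maxP pp Pp) => i _; apply: vgMl; first exact: OO_nat.
  by rewrite -[0](mul0rn _ i.+1); exact: (vgeX galE maxP pp Pp).
have {g1} : vg 1 (x ^+ p).
  by rewrite (_ : x ^+ p = (1 + p%:R * S + x ^+ p - 1) - p%:R * S); [exact: vgB | ring].
have [->|x0] := eqVneq x 0; first by move=> _; exact: vge0.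
move=> /(vge_neq0 (expf_neq0 _ x0)); rewrite (valX galE maxP pp Pp) // => le1.
split=> //; right; have := vge_neq0 x0 gx; case: (v x) le1 => // -[|n] //.
by rewrite mul0rn.
Qed.

(** By pigeonhole the residue of u has finite order, and factors p of the exponent are removed with
    [vge1_root]. *)
Lemma unit_root u : OO E u -> ~ P u -> exists2 k, ~~ (p %| k)%N & vg 1 (u ^+ k - 1).
Proof.
move=> Ou nPu; have idP := max_ideal maxP.
have [i [j [ltij Pij]]] := residue_pigeonhole pp idP Pp (fun n => OOX n Ou).
have OuX n : OO E (u ^+ n - 1) by apply: OOB; [exact: OOX | exact: OO1].
have : vg 1 (u ^+ (j - i) - 1).
  apply/(vge1P galE maxP pp Pp) => //.
  have : P (u ^+ i * (u ^+ (j - i) - 1)).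
    by rewrite mulrBr mulr1 -exprD subnKC 1?ltnW // -opprB; exact: (idealN idP).
  by case/(max_prime maxP (OOX _ Ou) (OuX _)) => // /(max_primeX maxP Ou).
have jigt0 : (0 < j - i)%N by rewrite subn_gt0.
have [k' npk ->] := pfactor_coprime pp jigt0.
elim: (logn _ _) => [|b IH].
  by rewrite expn0 muln1; exists k' => //; rewrite -prime_coprime.
rewrite expnSr mulnA exprM => /vge1_root h; apply: IH; apply: h.
exact/(vge_OO galE maxP pp Pp).
Qed.

Definition oneUnit (c : W) := c != 0 /\ vg 1 (c - 1).

Lemma oneUnit_mem c : oneUnit c -> c \in E.
Proof. by move=> [_ /vge_mem]; rewrite -{2}(subrK 1 c) => h; rewrite rpredD ?rpred1. Qed.

Lemma oneUnit_vge0 c : oneUnit c -> vg 0 c.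
Proof.
move=> [_ g]; rewrite -(subrK 1 c); apply: vgD; first by apply: vge_le g.
exact/(vge_OO galE maxP pp Pp)/OO1.
Qed.

Lemma oneUnit_val c : oneUnit c -> v c = 0.
Proof.
move=> [c0 g]; have [] := val_addl galE maxP pp Pp (oner_neq0 W) _ (rpred1 E) g.
  by rewrite (val1 maxP pp Pp).
by rewrite addrC subrK (val1 maxP pp Pp).
Qed.

Lemma oneUnitM c d : oneUnit c -> oneUnit d -> oneUnit (c * d).
Proof.
move=> uc ud; have [c0 gc] := uc; have [d0 gd] := ud; split; first exact: mulf_neq0.
rewrite (_ : c * d - 1 = c * (d - 1) + (c - 1)); last by ring.
by apply: vgD => //; apply: vgeM0 => //; exact: oneUnit_vge0.
Qed.

Lemma oneUnitV c : oneUnit c -> oneUnit c^-1.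
Proof.
move=> uc; have [c0 gc] := uc; have cE := oneUnit_mem uc.
split; first by rewrite invr_eq0.
rewrite (_ : c^-1 - 1 = c^-1 * (- (c - 1))); last by field.
apply: vgeM0; last exact: (vgeN galE maxP pp Pp).
split; rewrite ?rpredV //; right.
by rewrite (valV galE maxP pp Pp) // oneUnit_val.
Qed.

Lemma oneUnit1 : oneUnit 1.
Proof. by split; [exact: oner_neq0 | rewrite subrr; exact: vge0]. Qed.

Lemma oneUnit_exprz c (n : int) : oneUnit c -> oneUnit (c ^ n).
Proof.
move=> uc; have uX (k : nat) : oneUnit (c ^+ k).
  by elim: k => [|k IH]; [exact: oneUnit1 | rewrite exprS; exact: oneUnitM].
by case: n => k; [exact: uX | exact/oneUnitV/uX].
Qed.
End OneUnits.

(** * Automorphisms that act trivially modulo one-units *)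

Section Ramification.
Variable W : splittingFieldType rat.
Local Notation OO := ringOfIntegers.
Variables (E : {subfield W}) (P : set W) (p : nat).
Hypotheses (galE : galois 1%AS E) (maxP : isMaxIdeal E P) (pp : prime p) (Pp : P p%:R).
Local Notation v := (val E P).
Local Notation vg := (vge E P).
Variable s : {rmorphism W -> W}.
Hypotheses (sE : forall x, x \in E -> s x \in E)
  (s1 : forall x, x \in E -> x != 0 -> vg 1 (s x / x - 1))
  (s_neq : exists2 x, x \in E & s x != x).

Let vgD n x y : vg n x -> vg n y -> vg n (x + y). Proof. exact: (vgeD galE maxP pp Pp). Qed.
Let vgB n x y : vg n x -> vg n y -> vg n (x - y). Proof. exact: (vgeB galE maxP pp Pp). Qed.

Local Notation d x := (s x / x - 1).

(* The first jump of s: modulo elements of valuation > j, the map d is a *)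
(* nonzero homomorphism from the nonzero elements of E.                  *)
Lemma exists_jump : exists j : nat, [/\ (0 < j)%N,
  forall x, x \in E -> x != 0 -> vg j (d x)
  & ~ forall x, x \in E -> x != 0 -> vg j.+1 (d x)].
Proof.
have dE x : x \in E -> d x \in E by move=> xE; rewrite rpredB ?rpred1 // rpred_div ?sE.
pose Q (n : nat) := `[< exists x, [/\ x \in E, x != 0, d x != 0 & v (d x) = n%:Z] >].
have ge1 x : x \in E -> x != 0 -> d x != 0 -> (1 <= v (d x))%R.
  by move=> xE x0 dx0; apply: vge_neq0 => //; exact: s1.
have Q0 : exists n, Q n.
  have [x xE sx] := s_neq.
  have x0 : x != 0 by apply: contraNneq sx => ->; rewrite rmorph0.
  have dx0 : d x != 0.
    by rewrite subr_eq0; apply: contraNneq sx => sx1; rewrite -[s x](divfK x0) sx1 mul1r.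
  exists `|v (d x)|%N; apply/asboolP; exists x; split=> //.
  by rewrite gez0_abs // (le_trans _ (ge1 x xE x0 dx0)).
case: (ex_minnP Q0) => j /asboolP[x [xE x0 dx0 vdx]] minj; exists j; split.
- by have := ge1 x xE x0 dx0; rewrite vdx.
- move=> y yE y0; split; first exact: dE.
  have [->|dy0] := eqVneq (d y) 0; [by left | right].
  have ge := ge1 y yE y0 dy0; have vabs : v (d y) = (`|v (d y)|%N : int).
    by rewrite gez0_abs // (le_trans _ ge).
  by rewrite vabs lez_nat; apply: minj; apply/asboolP; exists y.
by move=> /(_ x xE x0) /(vge_neq0 dx0); rewrite vdx lez_nat ltnn.
Qed.

Section Jump.
Variable j : nat.
Hypotheses (j_gt0 : (0 < j)%N) (gej : forall x, x \in E -> x != 0 -> vg j (d x)).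
Local Notation Z x := (vg j.+1 x).

Lemma jumpM x y : x \in E -> y \in E -> x != 0 -> y != 0 ->
  Z (d (x * y) - (d x + d y)).
Proof.
move=> xE yE x0 y0; rewrite rmorphM.
rewrite (_ : _ - _ = d x * d y); last by field; rewrite x0 y0.
apply: (vge_le (n := j%:Z + j%:Z)); first by rewrite -PoszD lez_nat; lia.
by apply: (vgeM galE maxP pp Pp); exact: gej.
Qed.

Lemma jumpX x n : x \in E -> x != 0 -> Z (d (x ^+ n) - d x *+ n).
Proof.
move=> xE x0; elim: n => [|n IH].
  by rewrite expr0 rmorph1 divr1 mulr0n subrr subr0; exact: vge0.
rewrite exprS (_ : _ - _ = (d (x * x ^+ n) - (d x + d (x ^+ n))) + (d (x ^+ n) - d x *+ n)).
  by apply: vgD => //; apply: jumpM; rewrite ?rpredX ?expf_neq0.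
by rewrite mulrS; ring.
Qed.

Lemma jump_small y : vg 1 y -> Z (s y - y).
Proof.
move=> gy; have yE := vge_mem gy; have [->|y0] := eqVneq y 0.
  by rewrite rmorph0 subrr; exact: vge0.
rewrite (_ : s y - y = y * d y); last by field.
by rewrite -addn1 addnC PoszD; apply: (vgeM galE maxP pp Pp) => //; exact: gej.
Qed.

Lemma jump_oneUnit c : oneUnit E P c -> Z (d c).
Proof.
move=> uc; have [c0 gc] := uc.
rewrite (_ : d c = c^-1 * (s (c - 1) - (c - 1))); last by rewrite rmorphB rmorph1; field.
apply: (vgeM0 galE maxP pp Pp); last exact: jump_small.
exact/(oneUnit_vge0 galE maxP pp Pp)/(oneUnitV galE maxP pp Pp).
Qed.

(** d commutes with s, and s does not change the leading term of an element of positive valuation.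
    Hence all conjugates of x under s contribute equally to d of their product. *)
Lemma jump_conj x : x \in E -> x != 0 -> Z (d (s x) - d x).
Proof.
move=> xE x0; have -> : d (s x) = s (d x) by rewrite rmorphB fmorph_div rmorph1.
by apply: jump_small; exact: s1.
Qed.

Lemma jump_nat_inv x k : x \in E -> x != 0 -> ~~ (p %| k)%N -> Z (d (x ^+ k)) -> Z (d x).
Proof.
move=> xE x0 npk gxk; apply: (vge_mulrn_inv galE maxP pp Pp _ npk).
  by rewrite rpredB ?rpred1 // rpred_div ?sE.
rewrite -(subKr (d (x ^+ k)) (d x *+ k)); apply: vgB => //; exact: jumpX.
Qed.

Lemma jump_tame l x : (forall x, x \in E -> iter l s x = x) -> ~~ (p %| l)%N ->
  x \in E -> x != 0 -> Z (d x).
Proof.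
move=> sl npl xE x0; pose N n := \prod_(i < n) iter i s x.
have iE i : iter i s x \in E by elim: i => // i IH; exact: sE.
have i0 i : iter i s x != 0 by elim: i => // i IH; rewrite /= fmorph_eq0.
have NE n : N n \in E by rewrite rpred_prod // => i _; exact: iE.
(* d (N n) is n d x up to higher order, and N l is fixed by s. *)
have N0 n : N n != 0 by apply/prodf_neq0 => i _; exact: i0.
have dN n : Z (d (N n) - d x *+ n).
  elim: n => [|n IH].
    by rewrite /N big_ord0 rmorph1 divr1 mulr0n subrr subr0; exact: vge0.
  have di i : Z (d (iter i s x) - d x).
    elim: i => [|i IHi]; first by rewrite subrr; exact: vge0.
    rewrite (_ : _ - _ = (d (s (iter i s x)) - d (iter i s x)) + (d (iter i s x) - d x)).
      by apply: vgD => //; exact: jump_conj.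
    by rewrite /=; ring.
  have -> : N n.+1 = N n * iter n s x by rewrite /N big_ord_recr.
  rewrite (_ : _ - _ = (d (N n * iter n s x) - (d (N n) + d (iter n s x)))
    + (d (N n) - d x *+ n) + (d (iter n s x) - d x)); last by rewrite mulrS; ring.
  by apply: vgD => //; apply: vgD => //; exact: jumpM.
have sN : s (N l) = N l.
  apply: (mulfI x0); rewrite -{2}(sl x xE) /N rmorph_prod.
  by rewrite -(big_ord_recl l (fun i => iter i s x)) mulrC -(big_ord_recr l (fun i => iter i s x)).
apply: (vge_mulrn_inv galE maxP pp Pp _ npl).
  by rewrite rpredB ?rpred1 // rpred_div ?sE.
by have := dN l; rewrite sN divff // subrr sub0r => /(vgeN galE maxP pp Pp); rewrite opprK.
Qed.

(* A prime-to-p power of a unit is residually 1, so d vanishes at units to  *)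
(* first order; and x ^ e is a unit times a power of the fixed element a.    *)
Lemma jump_fixed a e x : a \in E -> a != 0 -> s a = a -> v a = e%:Z ->
  ~~ (p %| e)%N -> x \in E -> x != 0 -> Z (d x).
Proof.
move=> aE a0 sa va npe xE x0; apply: (jump_nat_inv xE x0 npe).
have Zunit u : OO E u -> ~ P u -> Z (d u).
  move=> Ou nPu; have [k npk gk] := unit_root galE maxP pp Pp Ou nPu.
  have u0 := nP_neq0 maxP nPu.
  apply: (jump_nat_inv _ u0 npk); first by case: Ou.
  by apply: jump_oneUnit; split=> //; exact: expf_neq0.
have [b ub] := exists_uniformizer maxP pp Pp.
have aX n : a ^ n \in E by case: n => n; rewrite ?NegzE -?invr_expz -exprnP ?rpredV rpredX.
have an0 n : a ^ n != 0 by rewrite expfz_neq0.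
have vaX (n : nat) : v (a ^+ n) = (n * e)%:Z.
  by rewrite (valX galE maxP pp Pp) // va -mulr_natl natz -PoszM.
pose y := x ^+ e / a ^ (v x).
have yE : y \in E by rewrite rpred_div ?rpredX.
have y0 : y != 0 by rewrite mulf_neq0 ?invr_eq0 ?expf_neq0.
have vy : v y = 0.
  have xeE : x ^+ e \in E by rewrite rpredX.
  have aV : (a ^ v x)^-1 \in E by rewrite rpredV.
  have aV0 : (a ^ v x)^-1 != 0 by rewrite invr_eq0.
  rewrite /y (valM galE maxP pp Pp xeE aV (expf_neq0 _ x0) aV0).
  rewrite (valV galE maxP pp Pp (aX _) (an0 _)) (valX galE maxP pp Pp _ xE x0).
  case: (v x) => n; last rewrite NegzE -invr_expz (valV galE maxP pp Pp) ?expf_neq0 ?rpredX //.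
    by rewrite -exprnP vaX -mulr_natl natz -PoszM mulnC subrr.
  by rewrite -exprnP vaX -mulr_natl natz mulrN -PoszM mulnC opprK addNr.
have [u [t [r [[Ot nPt] [Or nPr] tu]]]] := val_spec galE maxP pp Pp ub yE y0.
rewrite vy expr0z mul1r => yu; rewrite -{u}yu in tu.
have t0 := nP_neq0 maxP nPt.
have Zy : Z (d y).
  have tE : t \in E by case: Ot.
  rewrite (_ : d y = d (t * y) - d t - (d (t * y) - (d t + d y))); last by ring.
  apply: vgB; last exact: jumpM.
  by apply: vgB; [rewrite tu; exact: Zunit | exact: Zunit].
have -> : x ^+ e = y * a ^ (v x) by rewrite /y divfK.
rewrite -(subrK (d y + d (a ^ (v x))) (d _)); apply: vgD; first exact: jumpM.
by apply: vgD => //; rewrite fmorphXz sa divff // subrr; exact: vge0.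
Qed.
End Jump.

(** [jump_tame] contradicts the choice of the jump: a nontrivial element of the first ramification
    group does not have order prime to p. *)
Lemma no_tame_order l : ~~ (p %| l)%N -> ~ forall x, x \in E -> iter l s x = x.
Proof.
move=> npl sl; have [j [j0 gej]] := exists_jump; apply=> x xE x0.
exact: (jump_tame j0 gej sl npl).
Qed.

(** Again the leading term at the jump would vanish, by [jump_fixed]. Wildness of s thus shows in
    the valuations of the elements that s fixes. *)
Lemma no_tame_fixed a e : a \in E -> a != 0 -> s a = a -> v a = e%:Z -> (p %| e)%N.
Proof.
move=> aE a0 sa va; apply: contrapT => /negP npe.
have [j [j0 gej]] := exists_jump; apply=> x xE x0.
exact: (jump_fixed j0 gej aE a0 sa va npe).
Qed.
End Ramification.

(** * Inertia groups and the tame character *)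

Section Inertia.
Variable W : splittingFieldType rat.
Local Notation OO := ringOfIntegers.
Variables (L F : {subfield W}) (P : set W) (p : nat).
Hypotheses (galL : galois 1%AS L) (sFL : (F <= L)%VS).
Hypotheses (maxP : isMaxIdeal L P) (pp : prime p) (Pp : P p%:R).
Local Notation v := (val L P).
Local Notation vg := (vge L P).
Let idP := max_ideal maxP.

Let OOg (u : gal_of L) x : OO L x -> OO L (u x).
Proof. by apply: OO_rmorph => y; apply: memv_gal. Qed.

Definition inertial (u : gal_of L) := `[< forall x, OO L x -> P (u x - x) >].
Definition inertia : {set gal_of L} := [set u in 'Gal(L / F)%g | inertial u].

Lemma inertialP u : u \in inertia -> forall x, OO L x -> P (u x - x).
Proof. by rewrite inE => /andP[_ /asboolP]. Qed.

Lemma inertia_group : group_set inertia.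
Proof.
apply/group_setP; split=> [|s t].
  rewrite inE group1; apply/asboolP => x Ox; rewrite gal_id subrr.
  exact: ideal0 idP.
rewrite !inE => /andP[sG /asboolP sP] /andP[tG /asboolP tP]; rewrite groupM //=.
apply/asboolP => x Ox; rewrite galM; last by case: Ox.
by apply: (idealBC idP (tP _ (OOg s Ox))); exact: sP.
Qed.
Canonical inertia_Group := Group inertia_group.

Lemma inertial_stable u : u \in inertia -> u @` P = P.
Proof.
move=> uI; apply/esym; apply: (max_sub (max_gal u maxP) idP); last exact: max_proper maxP.
move=> _ [x Px <-]; rewrite -(subrK x (u x)); apply: (idealD idP) => //.
by apply: (inertialP uI); exact: ideal_sub Px.
Qed.

Lemma inertial_val u x : u \in inertia -> x \in L -> x != 0 -> v (u x) = v x.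
Proof.
by move=> uI xL x0; rewrite -{1}(inertial_stable uI) (val_gal _ galL maxP pp Pp).
Qed.

Lemma inertial_oneUnit u c : u \in inertia -> locUnit L P c -> oneUnit L P (u c / c).
Proof.
move=> uI uc; have c0 := locUnit_neq0 maxP uc; have cL := locUnit_mem maxP uc.
have vc := val_locUnit maxP pp Pp uc; case: (uc) => s [t [[Os nPs] [Ot nPt] sc]].
have gU y : OO L y -> ~ P y -> oneUnit L P (u y / y).
  move=> Oy nPy; have y0 := nP_neq0 maxP nPy; have yL : y \in L by case: Oy.
  split; first by rewrite mulf_neq0 ?invr_eq0 ?fmorph_eq0.
  rewrite (_ : _ - 1 = y^-1 * (u y - y)); last by field.
  apply: (vgeM0 galL maxP pp Pp).
    split; rewrite ?rpredV //; right.
    by rewrite (valV galL maxP pp Pp) // (val_nP maxP pp Pp).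
  apply/(vge1P galL maxP pp Pp); last exact: inertialP.
  by apply: OOB => //; exact: OOg.
have s0 := nP_neq0 maxP nPs.
have -> : u c / c = (u t / t) * (u s / s)^-1.
  by rewrite -sc rmorphM; field; rewrite c0 s0 fmorph_eq0 s0.
by apply: (oneUnitM galL maxP pp Pp); [exact: gU | apply: (oneUnitV galL maxP pp Pp); exact: gU].
Qed.

Lemma inertial_ratio_locUnit u x : u \in inertia -> x \in L -> x != 0 -> locUnit L P (u x / x).
Proof.
move=> uI xL x0; have [a ua] := exists_uniformizer maxP pp Pp.
have uxL : u x \in L by exact: memv_gal.
have ux0 : u x != 0 by rewrite fmorph_eq0.
have r0 : u x / x != 0 by rewrite mulf_neq0 ?invr_eq0.
have rL : u x / x \in L by rewrite rpred_div.
have [w uw] := val_spec galL maxP pp Pp ua rL r0.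
by rewrite (valM galL maxP pp Pp) ?rpredV ?invr_eq0 // (valV galL maxP pp Pp) //
  inertial_val // subrr expr0z mul1r => ->.
Qed.

(** Up to one-units, (u^m x)/x is the m-th power of u x / x, because inertia acts trivially on the
    residue of the unit (u^m x)/x. *)
Lemma inertial_ratioX u x n : u \in inertia -> x \in L -> x != 0 ->
  (u ^+ n)%g = 1%g -> oneUnit L P ((u x / x) ^+ n).
Proof.
move=> uI xL x0 un1; set c := u x / x.
have uc : locUnit L P c by exact: inertial_ratio_locUnit.
have c0 := locUnit_neq0 maxP uc.
have cL := locUnit_mem maxP uc.
suff h m : oneUnit L P (c ^+ m * (x / (u ^+ m)%g x)).
  by have := h n; rewrite un1 gal_id divff // mulr1.
elim: m => [|m IH].
  by rewrite expg0 gal_id divff // mulr1; exact: (oneUnit1).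
have umx : (u ^+ m)%g x \in L by exact: memv_gal.
have umx0 : (u ^+ m)%g x != 0 by rewrite fmorph_eq0.
have -> : c ^+ m.+1 * (x / (u ^+ m.+1)%g x) = (c ^+ m * (x / (u ^+ m)%g x)) *
   (u ((u ^+ m)%g x / x) / ((u ^+ m)%g x / x))^-1.
  rewrite expgSr galM // fmorph_div exprSr /c; field.
  by rewrite !fmorph_eq0 !x0.
apply: (oneUnitM galL maxP pp Pp) => //; apply: (oneUnitV galL maxP pp Pp).
by apply: inertial_oneUnit => //; apply: inertial_ratio_locUnit; rewrite ?groupX.
Qed.

Lemma val_prod (T : eqType) (s : seq T) (f : T -> W) n :
  (forall i, i \in s -> [/\ f i \in L, f i != 0 & v (f i) = n]) ->
  [/\ \prod_(i <- s) f i \in L, \prod_(i <- s) f i != 0 & v (\prod_(i <- s) f i) = n *+ size s].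
Proof.
elim: s => [|i s IH] h.
  by rewrite big_nil rpred1 oner_neq0 (val1 maxP pp Pp).
have [|pL p0 vp] := IH; first by move=> k ks; apply: h; rewrite inE ks orbT.
have [fL f0 vf] := h i (mem_head _ _).
rewrite big_cons rpredM // mulf_neq0 //; split=> //.
by rewrite (valM galL maxP pp Pp) // vp vf mulrS.
Qed.

Lemma vge_prod (T : Type) (s : seq T) (f : T -> W) n :
  (forall i, vg n (f i)) -> vg (n *+ size s) (\prod_(i <- s) f i).
Proof.
move=> h; elim: s => [|i s IH]; first by rewrite big_nil; apply: (vge_OO galL maxP pp Pp); exact: OO1.
by rewrite big_cons mulrS; apply: (vgeM galL maxP pp Pp).
Qed.

(* Multiplying by the functions s |-> s b - r b makes a linear combination of *)
(* the automorphisms vanish at every r outside inertia.                       *)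
Lemma inertia_separation (M : W -> Prop) (z : W) (S : seq (gal_of L)) :
  M 0 -> (forall x y, M x -> M y -> M (x + y)) -> (forall a x, OO L a -> M x -> M (a * x)) ->
  (forall y, OO L y -> M (\sum_(u in 'Gal(L / F)%g) u (z * y))) ->
  (forall r, r \in S -> ~~ inertial r) ->
  exists phi : gal_of L -> W, [/\ forall u, OO L (phi u), forall r, r \in S -> phi r = 0,
    ~ P (phi 1%g), forall u, inertial u -> P (phi u - phi 1%g)
  & forall y, OO L y -> M (\sum_(u in 'Gal(L / F)%g) phi u * u (z * y))].
Proof.
move=> M0 MD MZ Mtr; elim: S => [_|r S IH nI].
  exists (fun=> 1); split=> //; first by move=> _; exact: OO1.
  - exact: max_proper maxP.
  - by move=> u _; rewrite subrr; exact: ideal0 idP.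
  by move=> y Oy; under eq_bigr do rewrite mul1r; exact: Mtr.
have [|phi [Ophi phi0 nphi1 phiI Mphi]] := IH.
  by move=> q qS; apply: nI; rewrite inE qS orbT.
have /asboolPn/existsNP[b /not_implyP[Ob nPb]] := nI r (mem_head _ _).
exists (fun u => phi u * (u b - r b)); split.
- by move=> u; apply: OOM => //; apply: OOB; exact: OOg.
- by move=> q; rewrite inE => /predU1P[->|/phi0 ->]; rewrite ?subrr ?mulr0 ?mul0r.
- rewrite gal_id => /(max_prime maxP (Ophi _) (OOB Ob (OOg r Ob)))[//|].
  by move=> /(idealN idP); rewrite opprB.
- move=> u uI; rewrite gal_id.
  rewrite (_ : _ - _ = (phi u - phi 1%g) * (u b - r b) + phi 1%g * (u b - b)); last by ring.
  apply: (idealD idP); first by apply: (idealMr idP); [exact: phiI | apply: OOB; exact: OOg].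
  by apply: (idealMl idP) => //; move/asboolP: uI; apply.
move=> y Oy.
rewrite (_ : \sum_(_ in _) _ = \sum_(u in 'Gal(L / F)%g) phi u * u (z * (b * y))
  + (- r b) * \sum_(u in 'Gal(L / F)%g) phi u * u (z * y)); last first.
  by rewrite mulr_sumr -big_split; apply: eq_bigr => u _ /=; rewrite !rmorphM; ring.
apply: MD; first by apply: Mphi; exact: OOM.
by apply: MZ; [apply/OON/OOg | exact: Mphi].
Qed.

(* The element is a trace from L of z y, for z the product of the conjugates *)
(* under inertia of an element of valuation 1 and a suitable integer y.      *)
Lemma exists_val_inertia : ~~ (p %| #|inertia|)%N ->
  exists t, [/\ t \in F, t != 0 & v t = #|inertia|].
Proof.
move=> npI; set n := #|inertia|; apply: contrapT => nt.
have [a [Ia a0 va]] := exists_val1 galL pp maxP Pp.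
have Oa : OO L a by case: Ia.
have aL : a \in L by case: Oa.
pose z := \prod_(u in inertia) u a.
have zE : z = \prod_(u <- enum inertia) u a by rewrite big_enum.
have Oz : OO L z by apply: OO_prod => u _; exact: OOg.
have [zL z0 vz] : [/\ z \in L, z != 0 & v z = n].
  rewrite zE; have -> : (n : int) = 1%:Z *+ size (enum inertia).
    by rewrite -cardE -mulr_natl mulr1 natz.
  apply: val_prod => u; rewrite mem_enum => uI; rewrite memv_gal // fmorph_eq0 a0.
  by rewrite inertial_val.
have gal_a (u : gal_of L) : vg 1 (u a).
  apply/(vge1P galL maxP pp Pp); first exact: OOg.
  have Qp : ((u^-1)%g @` P) p%:R.
    by exists p%:R => //; rewrite rmorph_nat.
  have maxQ := max_gal (u^-1)%g maxP.
  have : ((u^-1)%g @` P) a by apply/(vge1P galL maxQ pp Qp) => //; case: Ia => _; apply.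
  by case=> y Py <-; rewrite gal_cancelV //; case: (ideal_sub idP Py).
have galFL : galois F L by apply: galoisS galL; rewrite sub1v.
(* Traces of multiples z y have valuation at least n; if no element of F has valuation n, they have
   valuation at least n + 1. *)
pose M := vg n.+1%:Z.
have Mtr y : OO L y -> M (\sum_(u in 'Gal(L / F)%g) u (z * y)).
  move=> Oy; set t := \sum_(_ in _) _.
  have tF : t \in F by apply: (mem_galTrace galFL); rewrite rpredM //; case: Oy.
  have [->|t0] := eqVneq t 0; first exact: vge0.
  have gt : vg n t.
    apply: (vge_sum galL maxP pp Pp) => u _; rewrite rmorphM mulrC.
    apply: (vgeMl galL maxP pp Pp); first exact: OOg.
    rewrite zE rmorph_prod; have -> : (n : int) = 1%:Z *+ size (enum inertia).
      by rewrite -cardE -mulr_natl mulr1 natz.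
    by apply: vge_prod => w /=; rewrite -galM //; exact: gal_a.
  split; first exact: vge_mem gt.
  right; have := vge_neq0 t0 gt; rewrite le_eqVlt => /predU1P[tn|]; last by [].
  by case: nt; exists t.
pose S := [seq r <- enum 'Gal(L / F)%g | ~~ inertial r].
have [|||||phi [Ophi phi0 nphi1 phiI Mphi]] := @inertia_separation M z S.
- exact: vge0.
- by move=> x y; exact: (vgeD galL maxP pp Pp).
- by move=> b x; exact: (vgeMl galL maxP pp Pp).
- exact: Mtr.
- by move=> r; rewrite mem_filter => /andP[].
(* Only the inertial terms survive and inertia fixes z, so the sum is T z with T congruent to n
   phi(1) modulo P. As p does not divide n, T is outside P and the valuation is exactly n, a
   contradiction. *)
have := Mphi 1 (OO1 L); rewrite mulr1.
rewrite (bigID inertial) /= [X in _ + X]big1 ?addr0; last first.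
  by move=> u /andP[uG nI]; rewrite phi0 ?mul0r // mem_filter nI mem_enum.
have -> : \sum_(u in 'Gal(L / F)%g | inertial u) phi u * u z = (\sum_(u in inertia) phi u) * z.
  rewrite mulr_suml; apply: eq_big => [u|u uI]; first by rewrite inE.
  congr (_ * _); rewrite /z rmorph_prod [RHS](reindex_inj (mulIg u)) /=.
  have uI' : u \in inertia by rewrite inE.
  by apply: eq_big => w; [rewrite (groupMr (G := inertia_Group)) | rewrite galM].
set T := \sum_(u in inertia) phi u.
have OT : OO L T by apply: OO_sum.
have nPT : ~ P T.
  have PT : P (T - n%:R * phi 1%g).
    rewrite /T /n mulr_natl -sumr_const -sumrB; apply: (ideal_sum idP) => u uI.
    by apply: phiI; move: uI; rewrite inE => /andP[].
  move=> /(idealB idP)/(_ PT); rewrite opprB addrC subrK.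
  move/(max_prime maxP (OO_nat _ _) (Ophi _)) => [/(max_nat maxP pp Pp)|//].
  by apply/negP.
have T0 := nP_neq0 maxP nPT.
move/(vge_neq0 (mulf_neq0 T0 z0)); rewrite (valM galL maxP pp Pp) //; last by case: OT.
by rewrite (val_nP maxP pp Pp) // add0r vz lez_nat ltnn.
Qed.
End Inertia.

(** * Coprimality of the two ramification indices *)

Section Abhyankar.
Variable W : splittingFieldType rat.
Local Notation OO := ringOfIntegers.

(** Take e to be the ramification index. If no element of F had valuation e, all elements of the
    extension of the prime below P would have valuation above e, whereas its factorization produces
    one of valuation e. *)
Lemma tame_val (F K : {subfield W}) (P : set W) (p : nat) :
  galois 1%AS K -> prime p -> isMaxIdeal K P -> P p%:R ->
  tamelyRamified F K p ->
  exists a (e : nat), [/\ a \in F, a \in K, a != 0, val K P a = e & ~~ (p %| e)%N].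
Proof.
move=> galK pp maxP Pp /(_ P maxP Pp); have idP := max_ideal maxP.
(* Without a factorization [ramIndex] would take its default value 0, which p divides, against
   tameness. *)
rewrite /ramIndex; case: xgetP => [e _ [J [idJ nJP extE]] npe|_]; last by rewrite dvdn0.
apply: contrapT => na.
have [z Jz nPz] : exists2 z, J z & ~ P z.
  by apply: contrapT => nz; apply: nJP => z Jz; apply: contrapT => nPz; apply: nz; exists z.
have Oz := ideal_sub idJ Jz; have zK : z \in K by case: Oz.
have [b ub] := exists_uniformizer maxP pp Pp.
have bK := uniformizer_mem maxP ub; have b0 := uniformizer_neq0 maxP pp Pp ub.
have expb n : expIdeal K P n (b ^+ n).
  elim: n => [|n IH]; first exact: OO1.
  by rewrite exprS; apply: mulIdeal_prod => //; exact: ub.1.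
have ge_exp (n : nat) x : expIdeal K P n x -> vge K P n x.
  elim: n x => [|n IH] x; first exact: (vge_OO galK maxP pp Pp).
  apply: (mulIdeal_sub (S := vge K P n.+1)) => [|y w|y w Py ew]; first exact: vge0.
    exact: (vgeD galK maxP pp Pp).
  rewrite -add1n PoszD; apply: (vgeM galK maxP pp Pp); last exact: IH.
  by apply/(vge1P galK maxP pp Pp) => //; exact: (ideal_sub idP).
have geR x : mulIdeal (expIdeal K P e) J x -> vge K P e x.
  apply: (mulIdeal_sub (S := vge K P e)) => [|y w|y w ey Jw]; first exact: vge0.
    exact: (vgeD galK maxP pp Pp).
  rewrite mulrC; apply: (vgeMl galK maxP pp Pp); last exact: ge_exp.
  exact: (ideal_sub idJ).
have geL x : extIdeal K (P `&` OO F) x -> vge K P e.+1 x.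
  apply: (mulIdeal_sub (S := vge K P e.+1)) => [|y w|y w [Py [yF iy]] Ow]; first exact: vge0.
    exact: (vgeD galK maxP pp Pp).
  rewrite mulrC; apply: (vgeMl galK maxP pp Pp) => //.
  have yK : y \in K by case: (ideal_sub idP Py).
  have : vge K P e y.
    by apply: geR; rewrite -extE -[y]mulr1; apply: mulIdeal_prod => //; exact: OO1.
  have [->|y0] := eqVneq y 0; first by move=> _; exact: vge0.
  move/(vge_neq0 y0); rewrite le_eqVlt => /predU1P[ye|lt]; last by split=> //; right.
  by case: na; exists y, e.
have bz : extIdeal K (P `&` OO F) (b ^+ e * z) by rewrite extE; exact: mulIdeal_prod.
have z0 := nP_neq0 maxP nPz.
have := vge_neq0 (mulf_neq0 (expf_neq0 e b0) z0) (geL _ bz).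
rewrite (valM galK maxP pp Pp) ?rpredX ?expf_neq0 // (val_nP maxP pp Pp Oz nPz) addr0.
by rewrite (valX galK maxP pp Pp) // (val_uniformizer maxP pp Pp ub) -mulr_natl mulr1 natz lez_nat ltnn.
Qed.

Variables (L K1 K2 F : {subfield W}) (p : nat) (P : set W) (e1 e2 : nat).
Hypotheses (galL : galois 1%AS L) (galK1 : galois 1%AS K1) (galK2 : galois 1%AS K2).
Hypotheses (sFK2 : (F <= K2)%VS) (sK1L : (K1 <= L)%VS) (sK2L : (K2 <= L)%VS).
Hypothesis sLK : (L <= K1 * K2)%VS.
Hypotheses (pp : prime p) (maxP : isMaxIdeal L P) (Pp : P p%:R).
Hypotheses (e1_gt0 : (0 < e1)%N) (e2_gt0 : (0 < e2)%N).
Hypothesis e1P : forall x, x \in K1 -> x != 0 -> val L P x = val K1 (P `&` OO K1) x * e1.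
Hypothesis e2P : forall x, x \in K2 -> x != 0 -> val L P x = val K2 (P `&` OO K2) x * e2.
Local Notation P1 := (P `&` OO K1).
Let maxP1 : isMaxIdeal K1 P1. Proof. exact: max_restrict sK1L pp maxP Pp. Qed.
Let P1p : P1 p%:R. Proof. by split=> //; exact: OO_nat. Qed.

Lemma gal_nontrivial (u : gal_of L) : u \in 'Gal(L / K2)%g -> u != 1%g ->
  exists2 x, x \in K1 & u x != x.
Proof.
move=> uG u1; apply: contrapT => nx.
have uK1 x : x \in K1 -> u x = x.
  by move=> xK; apply/eqP/negPn/negP => ux; apply: nx; exists x.
move/negP: u1; apply; apply/gal_eqP => x xL; rewrite gal_id.
have : (K1 * K2 <= fixedSpace u)%VS.
  apply: prodv_sub; apply/subvP => y yK; apply/fixedSpaceP; first exact: uK1.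
  exact: (fixed_gal sK2L uG).
by move/subvP/(_ x (subvP sLK _ xL))/fixedSpaceP.
Qed.

Lemma ramification_restrict (u : gal_of L) x : u \in inertia L K2 P ->
  oneUnit L P (u x / x) -> x \in K1 -> x != 0 -> vge K1 P1 1 (u x / x - 1).
Proof.
move=> uI [_ g] xK x0; have uxK : u x \in K1 by apply: aend_stable.
have cK : u x / x - 1 \in K1 by rewrite rpredB ?rpred1 ?rpred_div.
have [->|c0] := eqVneq (u x / x - 1) 0; first exact: vge0.
split=> //; right; have := vge_neq0 c0 g; rewrite e1P //.
by rewrite -!gtz0_ge1 pmulr_lgt0 // ltz_nat.
Qed.

(** If u in inertia has order p, then (u x / x)^p is congruent to 1, hence so is u x / x, and
    [no_tame_fixed] applies to u on K1. As u fixes K2, it fixes the element of F given by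
    [tame_val], whose valuation is prime to p. *)
Lemma wild_inertia_trivial : tamelyRamified F K1 p -> ~~ (p %| #|inertia L K2 P|)%N.
Proof.
move=> tame; apply/negP => pI.
have [u uI up] := Cauchy pp (G := inertia_Group K2 maxP) pI.
have uG : u \in 'Gal(L / K2)%g by move: uI; rewrite inE => /andP[].
have u1 : u != 1%g by apply: contraTneq (prime_gt1 pp) => u1; rewrite -up u1 order1.
have upX : (u ^+ p)%g = 1%g by rewrite -up expg_order.
have [a [e [aF aK a0 va npe]]] := tame_val galK1 pp maxP1 P1p tame.
have one x : x \in K1 -> x != 0 -> oneUnit L P (u x / x).
  move=> xK x0; have xL : x \in L by exact: (subvP sK1L).
  have uc := inertial_ratio_locUnit galL maxP pp Pp uI xL x0.
  split; first exact: (locUnit_neq0 maxP uc).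
  have [_] := inertial_ratioX galL maxP pp Pp uI xL x0 upX.
  apply: (vge1_root galL maxP pp Pp).
  apply: (vgeB galL maxP pp Pp); last by apply: (vge_OO galL maxP pp Pp); exact: OO1.
  split; first exact: (locUnit_mem maxP uc).
  by right; rewrite (val_locUnit maxP pp Pp uc).
case/negP: npe; apply: (@no_tame_fixed _ K1 P1 p galK1 maxP1 pp P1p (gal_repr u) _ _ _ a e) => //.
- by move=> x; apply: aend_stable.
- by move=> x xK x0; apply: ramification_restrict => //; exact: one.
- exact: gal_nontrivial.
by apply: (fixed_gal sK2L uG); exact: (subvP sFK2).
Qed.

(** For x in K1 the valuation in L is a multiple of e1, hence of l. So if u in inertia has order l,
    u x / x is up to one-units a power of (u b / b)^l, itself a one-unit, and [no_tame_order]
    applies to u on K1. *)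
Lemma tame_inertia_exclusive l : prime l -> l != p -> (l %| e1)%N ->
  ~~ (l %| #|inertia L K2 P|)%N.
Proof.
move=> lp lnp /dvdnP[m e1m]; apply/negP => lI.
have [u uI ul] := Cauchy lp (G := inertia_Group K2 maxP) lI.
have uG : u \in 'Gal(L / K2)%g by move: uI; rewrite inE => /andP[].
have u1 : u != 1%g by apply: contraTneq (prime_gt1 lp) => u1; rewrite -ul u1 order1.
have ulX : (u ^+ l)%g = 1%g by rewrite -ul expg_order.
have [b ub] := exists_uniformizer maxP pp Pp.
have bL := uniformizer_mem maxP ub; have b0 := uniformizer_neq0 maxP pp Pp ub.
have one x : x \in K1 -> x != 0 -> oneUnit L P (u x / x).
  move=> xK x0; have xL : x \in L by exact: (subvP sK1L).
  have [w uw xE] := val_spec galL maxP pp Pp ub xL x0.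
  have w0 := locUnit_neq0 maxP uw.
  have -> : u x / x = ((u b / b) ^+ l) ^ (val K1 P1 x * m) * (u w / w).
    rewrite {1 2}xE rmorphM fmorphXz e1P // e1m PoszM mulrA.
    set k := val K1 P1 x; rewrite exprnP exprz_exp [l%:Z * _]mulrC.
    by rewrite exprzMl ?unitfE ?invr_eq0 ?fmorph_eq0 // exprz_inv -invr_expz invfM mulrACA.
  apply: (oneUnitM galL maxP pp Pp).
    apply: (oneUnit_exprz galL maxP pp Pp).
    exact: (inertial_ratioX galL maxP pp Pp uI bL b0 ulX).
  exact: (inertial_oneUnit galL maxP pp Pp uI uw).
have npl : ~~ (p %| l)%N by rewrite dvdn_prime2 // eq_sym.
apply: (@no_tame_order _ K1 P1 p galK1 maxP1 pp P1p (gal_repr u) _ _ _ l npl).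
- by move=> x; apply: aend_stable.
- by move=> x xK x0; apply: ramification_restrict => //; exact: one.
- exact: gal_nontrivial.
move=> x xK; have xL : x \in L by exact: (subvP sK1L).
have iterE n : iter n (gal_repr u) x = (u ^+ n)%g x.
  elim: n => [|n IH]; first by rewrite expg0 gal_id.
  by rewrite iterS IH expgSr galM.
by rewrite iterE ulX gal_id.
Qed.

(** An element of K2 whose valuation is the order of inertia shows that e2 divides this order. A
    common prime factor of e1 and e2 then divides it too, which [wild_inertia_trivial] excludes for
    p and [tame_inertia_exclusive] for other primes. *)
Lemma coprime_ramification : tamelyRamified F K1 p -> coprime e1 e2.
Proof.
move=> tame; have npI := wild_inertia_trivial tame.
have [t [tK t0 vt]] := exists_val_inertia galL sK2L maxP pp Pp npI.
have e2I : (e2 %| #|inertia L K2 P|)%N.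
  have : (e2%:Z %| #|inertia L K2 P|%:Z)%Z.
    by rewrite -vt e2P //; exact: dvdz_mull.
  by [].
rewrite /coprime; apply/negPn/negP => g1.
have g_gt1 : (1 < gcdn e1 e2)%N.
  by rewrite ltn_neqAle eq_sym g1 gcdn_gt0 e1_gt0.
have lp := pdiv_prime g_gt1; have := pdiv_dvd (gcdn e1 e2).
rewrite dvdn_gcd => /andP[l1 /dvdn_trans/(_ e2I) lI].
have [lE|lnp] := eqVneq (pdiv (gcdn e1 e2)) p.
  by move: npI; rewrite -lE lI.
by move: lI; apply/negP; exact: tame_inertia_exclusive.
Qed.
End Abhyankar.

(** * Ideal classes *)

Section ClassGroup.
Variable W : splittingFieldType rat.
Local Notation OO := ringOfIntegers.
Implicit Types (E F K L : {subfield W}) (I J P : set W) (c d : set (set W)).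

Lemma scale1_set I : [set 1 * x | x in I] = I.
Proof. by apply/seteqP; split=> [_ [x Ix <-]|x Ix]; [rewrite mul1r | exists x; rewrite ?mul1r]. Qed.

Lemma scale_set I a b : [set a * x | x in [set b * x | x in I]] = [set a * b * x | x in I].
Proof.
apply/seteqP; split=> [_ [_ [x Ix <-] <-]|_ [x Ix <-]]; first by exists x => //; rewrite mulrA.
by exists (b * x); [exists x | rewrite mulrA].
Qed.

Lemma idealClass_refl E I : idealClass E I I.
Proof. by exists 1; [split; [exact: rpred1 | exact: oner_neq0] | exact: scale1_set]. Qed.

Lemma idealClass_scale E I a : a \in E -> a != 0 ->
  idealClass E [set a * x | x in I] = idealClass E I.
Proof.
move=> aE a0; apply/seteqP; split=> _ [b [bE b0] <-].
  by exists (b * a); [split; [exact: rpredM | exact: mulf_neq0] | rewrite scale_set].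
exists (b / a); first by split; [exact: rpred_div | rewrite mulf_neq0 ?invr_eq0].
by rewrite scale_set divfK.
Qed.

Lemma mulClass_ideal E I J :
  mulClass (idealClass E I) (idealClass E J) = idealClass E (mulIdeal I J).
Proof.
apply/seteqP; split=> [_ [_ [a [aE a0] <-] [_ [b [bE b0] <-] <-]]|_ [a [aE a0] <-]].
  by rewrite mulIdealZ; exists (a * b) => //; split; [exact: rpredM | exact: mulf_neq0].
exists [set a * x | x in I]; first by exists a.
exists J; first exact: idealClass_refl.
by rewrite -[X in mulIdeal _ X]scale1_set mulIdealZ mulr1.
Qed.

Lemma extIdeal_scale E I a : extIdeal E [set a * x | x in I] = [set a * x | x in extIdeal E I].
Proof. by rewrite /extIdeal -[X in mulIdeal _ X = _]scale1_set mulIdealZ mulr1. Qed.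

Lemma extClass_ideal E F I : (F <= E)%VS ->
  extClass E (idealClass F I) = idealClass E (extIdeal E I).
Proof.
move=> /subvP sFE; apply/seteqP; split=> [X [_ [a [aF a0] <-]]|X clX].
  by rewrite extIdeal_scale idealClass_scale //; exact: sFE.
by exists I => //; exact: idealClass_refl.
Qed.

Lemma extIdealM E I J :
  extIdeal E (mulIdeal I J) = mulIdeal (extIdeal E I) (extIdeal E J).
Proof.
apply/seteqP; split.
  apply: (mulIdeal_sub (S := mulIdeal (extIdeal E I) (extIdeal E J))) => [|x y|x a IJx Oa].
  - exact: mulIdeal0.
  - exact: mulIdealD.
  move: x IJx.
  apply: (mulIdeal_sub (S := fun x => mulIdeal (extIdeal E I) (extIdeal E J) (x * a))) => [|x y|x y Ix Jy].
  - by rewrite mul0r; exact: mulIdeal0.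
  - by rewrite mulrDl; exact: mulIdealD.
  rewrite -mulrA -[x]mulr1; apply: mulIdeal_prod; last exact: mulIdeal_prod.
  by apply: mulIdeal_prod => //; exact: OO1.
apply: (mulIdeal_sub (S := extIdeal E (mulIdeal I J))) => [|x y|x y Ix Jy].
- exact: mulIdeal0.
- exact: mulIdealD.
move: x Ix; apply: (mulIdeal_sub (S := fun x => extIdeal E (mulIdeal I J) (x * y))) => [|x x'|x a Ix Oa].
- by rewrite mul0r; exact: mulIdeal0.
- by rewrite mulrDl; exact: mulIdealD.
move: y Jy; apply: (mulIdeal_sub (S := fun y => extIdeal E (mulIdeal I J) (x * a * y))) => [|y y'|y b Jy Ob].
- by rewrite mulr0; exact: mulIdeal0.
- by rewrite mulrDr; exact: mulIdealD.
by rewrite mulrACA; apply: mulIdeal_prod; [exact: mulIdeal_prod | exact: OOM].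
Qed.

Lemma extIdeal_OO E F : (F <= E)%VS -> extIdeal E (OO F) = OO E.
Proof.
move=> sFE; apply: (ideal1 (ideal_ext sFE (idealO F))).
by rewrite -[1]mulr1; apply: mulIdeal_prod; exact: OO1.
Qed.

Lemma isFracIdeal_ideal E I x : isIdeal E I -> I x -> x != 0 -> isFracIdeal E I.
Proof.
move=> idI Ix x0; split.
- by case: idI.
- by move=> y /(ideal_sub idI)[].
- by exists x.
exists 1; split; [exact: OO1 | exact: oner_neq0 | move=> y Iy].
by rewrite mul1r; exact: (ideal_sub idI).
Qed.

Lemma isFracIdeal_mul E I J : isFracIdeal E I -> isFracIdeal E J ->
  isFracIdeal E (mulIdeal I J).
Proof.
move=> [subI IE [x Ix x0] [a [Oa a0 aI]]] [subJ JE [y Jy y0] [b [Ob b0 bJ]]]; split.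
- exact: OSubmodule_mulIdeal.
- apply: (mulIdeal_sub (S := [set x | x \in E])) => /= [|z w|z w /IE zE /JE wE].
  + exact: rpred0.
  + exact: rpredD.
  + exact: rpredM.
- by exists (x * y); [exact: mulIdeal_prod | exact: mulf_neq0].
exists (a * b); split; [exact: OOM | exact: mulf_neq0 |].
apply: (mulIdeal_sub (S := fun x => OO E (a * b * x))) => [|z w|z w Iz Jw].
- by rewrite mulr0; exact: OO0.
- by rewrite mulrDr; exact: OOD.
- by rewrite mulrACA; apply: OOM; [exact: aI | exact: bJ].
Qed.

Lemma isFracIdeal_ext E F I : (F <= E)%VS -> isFracIdeal F I -> isFracIdeal E (extIdeal E I).
Proof.
move=> sFE [subI IF [x Ix x0] [a [Oa a0 aI]]]; split.
- by rewrite /extIdeal mulIdealC; apply: OSubmodule_mulIdeal; case: (idealO E).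
- apply: (mulIdeal_sub (S := [set x | x \in E])) => /= [|z w|z w /IF zF [wE _]].
  + exact: rpred0.
  + exact: rpredD.
  + by apply: rpredM => //; exact: (subvP sFE).
- by exists x => //; rewrite -[x]mulr1; apply: mulIdeal_prod => //; exact: OO1.
exists a; split=> //; first exact: (OO_sub sFE).
apply: (mulIdeal_sub (S := fun x => OO E (a * x))) => [|z w|z w Iz Ow].
- by rewrite mulr0; exact: OO0.
- by rewrite mulrDr; exact: OOD.
- by rewrite mulrA; apply: OOM => //; apply: (OO_sub sFE); exact: aI.
Qed.

Lemma PiIdeal_cases E q : galois 1%AS E ->
  PiIdeal E q = OO E \/ exists p P, [/\ prime p, isMaxIdeal E P, P p%:R & hasNorm E P q].
Proof.
move=> galE.
have [[P [maxP Pq]]|nP] := pselect (exists P, isMaxIdeal E P /\ hasNorm E P q).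
  by right; have [p pp Pp] := max_over_prime galE maxP; exists p, P.
left; rewrite /PiIdeal (_ : [set _ | _] = set0) ?fset_set0 ?big_nil //.
by apply/seteqP; split=> // P maxP; apply: nP; exists P.
Qed.

Lemma isFracIdeal_ordIdeal E p n : galois 1%AS E -> prime p -> isFracIdeal E (ordIdeal E p n).
Proof.
move=> galE pp; apply: (isFracIdeal_ideal (ideal_ordIdeal galE pp n) (ordIdeal_natX galE pp n)).
by rewrite expf_neq0 // natrW_eq0 -lt0n prime_gt0.
Qed.

Lemma isFracIdeal_PiIdeal E q : galois 1%AS E -> isFracIdeal E (PiIdeal E q).
Proof.
move=> galE; have [->|[p [P [pp maxP Pp Pq]]]] := PiIdeal_cases q galE.
  exact: (isFracIdeal_ideal (idealO E) (OO1 E) (oner_neq0 _)).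
by rewrite (PiIdeal_ordIdeal galE pp maxP Pp Pq); exact: isFracIdeal_ordIdeal.
Qed.

(** * Subgroups of the class group and Pólya groups *)

Section Subgroup.
Variables (L : {subfield W}) (H : set (set (set W))).
Hypotheses (galL : galois 1%AS L) (subH : isSubgroup L H).

Lemma subgroup_ordIdealD p m n : prime p -> H (idealClass L (ordIdeal L p m)) ->
  H (idealClass L (ordIdeal L p n)) -> H (idealClass L (ordIdeal L p (m + n))).
Proof.
case: subH => _ _ HM _ pp Hm Hn.
by rewrite -(ordIdealM galL pp) -mulClass_ideal; exact: HM.
Qed.

Lemma subgroup_ordIdealX p m k : prime p -> H (idealClass L (ordIdeal L p m)) ->
  H (idealClass L (ordIdeal L p (k * m))).
Proof.
move=> pp Hm; elim: k => [|k IH]; last by rewrite mulSn; exact: subgroup_ordIdealD.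
by rewrite mul0n (ordIdeal0 galL pp); case: subH.
Qed.

(** Bezout gives km m = kn n + 1. Since valuation e is principal, -kn n may be replaced by kn (e -
    1) n, which avoids inverses of ideals. *)
Lemma subgroup_ordIdeal_coprime p m n : prime p -> (0 < m)%N -> coprime m n ->
  H (idealClass L (ordIdeal L p m)) -> H (idealClass L (ordIdeal L p n)) ->
  H (idealClass L (ordIdeal L p 1)).
Proof.
move=> pp m_gt0 /eqP co Hm Hn; have [e e_gt0 eE] := principal_ordIdeal galL pp.
case: (egcdnP n m_gt0) => km kn kE _.
have : H (idealClass L (ordIdeal L p (km * m + kn * e.-1 * n))).
  by apply: subgroup_ordIdealD => //; exact: subgroup_ordIdealX.
have -> : (km * m + kn * e.-1 * n = 1 + (kn * n) * e)%N.
  by rewrite kE co -{2}(prednK e_gt0); lia.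
(* The surplus kn n e is removed e at a time, each time as a factor generated by p. *)
elim: (kn * n)%N => [//|k IH]; rewrite mulSn addnCA addnC -(ordIdealM galL pp) -eE.
rewrite -[X in mulIdeal X _]scale1_set mulIdealZ mul1r idealClass_scale.
- rewrite mulIdeal1 => [/IH//|]; by case: (ideal_ordIdeal galL pp (1 + k * e)).
- exact: rpred_nat.
- by rewrite natrW_eq0 -lt0n prime_gt0.
Qed.
End Subgroup.

Lemma extClass_PiIdeal L K p P q : galois 1%AS L -> galois 1%AS K -> (K <= L)%VS ->
  prime p -> isMaxIdeal K P -> P p%:R -> hasNorm K P q ->
  forall e : nat, (0 < e)%N -> (forall Q, isMaxIdeal L Q -> Q p%:R ->
    forall x, x \in K -> x != 0 -> val L Q x = val K (Q `&` OO K) x * e) ->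
  extClass L (idealClass K (PiIdeal K q)) = idealClass L (ordIdeal L p e).
Proof.
move=> galL galK sKL pp maxP Pp Pq e e_gt0 eP.
by rewrite extClass_ideal // (PiIdeal_ordIdeal galK pp maxP Pp Pq) (ext_ordIdeal galL galK sKL pp e_gt0).
Qed.

(** The classes whose extension lies in H form a subgroup, so only generators matter; each extends
    to the unit ideal or to a power of [ordIdeal L p 1], which is itself a [PiIdeal] of L. *)
Lemma polya_ext L K H : galois 1%AS L -> galois 1%AS K -> (K <= L)%VS ->
  isSubgroup L H -> (forall q, (0 < q)%N -> H (idealClass L (PiIdeal L q))) ->
  forall c, polyaGroup K c -> H (extClass L c).
Proof.
move=> galL galK sKL subH HPi; have [Hcl H1 HM HV] := subH.
pose A := [set c | classGroup K c /\ H (extClass L c)].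
suff: polyaGroup K `<=` A by move=> sub c /sub[].
have extM I J : extClass L (mulClass (idealClass K I) (idealClass K J)) =
    mulClass (extClass L (idealClass K I)) (extClass L (idealClass K J)).
  by rewrite mulClass_ideal !extClass_ideal // extIdealM mulClass_ideal.
have ext1 : extClass L (oneClass K) = oneClass L.
  by rewrite /oneClass extClass_ideal // extIdeal_OO.
apply: smallest_sub.
  split.
  - by move=> c [].
  - split; last by rewrite ext1.
    by exists (OO K) => //; exact: (isFracIdeal_ideal (idealO K) (OO1 K) (oner_neq0 _)).
  - move=> _ _ [[I fI <-] HI] [[J fJ <-] HJ]; split; last by rewrite extM; exact: HM.
    by rewrite mulClass_ideal; exists (mulIdeal I J) => //; exact: isFracIdeal_mul.
  move=> _ _ [[I fI <-] HI] [J fJ <-] IJ; split; first by exists J.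
  apply: (HV (extClass L (idealClass K I))) => //; last by rewrite -extM IJ.
  by rewrite extClass_ideal //; exists (extIdeal L J) => //; exact: (isFracIdeal_ext sKL).
move=> _ [q q_gt0 <-]; split; first by exists (PiIdeal K q) => //; exact: isFracIdeal_PiIdeal.
have [->|[p [P [pp maxP Pp Pq]]]] := PiIdeal_cases q galK; first by rewrite ext1.
have [e [e_gt0 eP]] := val_restrict galL galK sKL pp.
rewrite (extClass_PiIdeal galL galK sKL pp maxP Pp Pq e_gt0 eP).
rewrite -[e]muln1; apply: subgroup_ordIdealX => //.
have [Q maxQ Qp] := exists_max_over L pp.
have [k [k_gt0 Qk]] := max_hasNorm pp maxQ Qp.
rewrite -(PiIdeal_ordIdeal galL pp maxQ Qp Qk); apply: HPi.
by rewrite expn_gt0 prime_gt0.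
Qed.

(** [ordIdeal L p e] is extended from the product of the primes of K above p, and these are the
    maximal ideals of norm p^k for some k. *)
Lemma sub_polya_ext L K (H : set (set (set W))) p : galois 1%AS L -> galois 1%AS K -> (K <= L)%VS -> prime p ->
  (forall c, polyaGroup K c -> H (extClass L c)) ->
  forall e : nat, (0 < e)%N -> (forall Q, isMaxIdeal L Q -> Q p%:R ->
    forall x, x \in K -> x != 0 -> val L Q x = val K (Q `&` OO K) x * e) ->
  H (idealClass L (ordIdeal L p e)).
Proof.
move=> galL galK sKL pp HK e e_gt0 eP.
have [P maxP Pp] := exists_max_over K pp.
have [k [k_gt0 Pk]] := max_hasNorm pp maxP Pp.
rewrite -(extClass_PiIdeal galL galK sKL pp maxP Pp Pk e_gt0 eP); apply: HK.
move=> M [_ genM]; apply: genM; exists (p ^ k)%N => //=.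
by rewrite expn_gt0 prime_gt0.
Qed.

(** Separability comes from characteristic zero, and an automorphism of W that preserves K1 and K2
    preserves their compositum. *)
Lemma galois_prod K1 K2 : galois 1%AS K1 -> galois 1%AS K2 -> galois 1%AS (K1 * K2)%AS.
Proof.
move=> galK1 galK2; apply/and3P; split.
- exact: sub1v.
- apply/separableP => y _; apply: pcharf0_separable => p; apply/negP => /andP[pp].
  by rewrite natrW_eq0 => /eqP p0; rewrite p0 in pp.
apply/forall_inP => g _.
rewrite -dimv_leqif_eq ?limg_dim_eq ?(eqP (AEnd_lker0 g)) ?capv0 // aimgM.
by apply: prodvS; apply/subvP => _ /memv_imgP[x xK ->]; apply: aend_stable.
Qed.

Lemma polya_sub_ext (L K1 K2 F : {subfield W}) (H : set (set (set W))) :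
  galois 1%AS L -> galois 1%AS K1 -> galois 1%AS K2 ->
  (K1 <= L)%VS -> (K2 <= L)%VS -> (L <= K1 * K2)%VS -> (F <= K1)%VS -> (F <= K2)%VS ->
  (forall p, prime p -> tamelyRamified F K1 p \/ tamelyRamified F K2 p) ->
  isSubgroup L H -> (forall c, polyaGroup K1 c -> H (extClass L c)) ->
  (forall c, polyaGroup K2 c -> H (extClass L c)) -> polyaGroup L `<=` H.
Proof.
move=> galL galK1 galK2 sK1 sK2 sLK sFK1 sFK2 tame subH H1 H2.
apply: smallest_sub => // _ [q q_gt0 <-].
have [->|[p [P [pp maxP Pp Pq]]]] := PiIdeal_cases q galL; first by case: subH.
rewrite (PiIdeal_ordIdeal galL pp maxP Pp Pq).
have [e1 [e1_gt0 e1P]] := val_restrict galL galK1 sK1 pp.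
have [e2 [e2_gt0 e2P]] := val_restrict galL galK2 sK2 pp.
apply: (@subgroup_ordIdeal_coprime L H galL subH p e1 e2 pp e1_gt0).
- have [tame1|tame2] := tame p pp.
    exact: (coprime_ramification galL galK1 sFK2 sK1 sK2 sLK pp maxP Pp e1_gt0
      (e1P P maxP Pp) (e2P P maxP Pp) tame1).
  rewrite coprime_sym; have sLK' : (L <= K2 * K1)%VS by rewrite prodvC.
  exact: (coprime_ramification galL galK2 sFK1 sK2 sK1 sLK' pp maxP Pp e2_gt0
    (e2P P maxP Pp) (e1P P maxP Pp) tame2).
- exact: (sub_polya_ext galL galK1 sK1 pp H1 e1_gt0 e1P).
- exact: (sub_polya_ext galL galK2 sK2 pp H2 e2_gt0 e2P).
Qed.
End ClassGroup.

Theorem proposition3p5 (W : splittingFieldType rat) (K1 K2 : {subfield W})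
  (galK1 : galois 1%AS K1) (galK2 : galois 1%AS K2)
  (tame : forall p : nat, prime p ->
     tamelyRamified (K1 :&: K2)%AS K1 p \/ tamelyRamified (K1 :&: K2)%AS K2 p) :
  polyaGroup (K1 * K2)%AS =
  sumSubgroup (K1 * K2)%AS
    [set extClass (K1 * K2)%AS c | c in polyaGroup K1]
    [set extClass (K1 * K2)%AS c | c in polyaGroup K2].
Proof.
have galL := galois_prod galK1 galK2.
have sK1 : (K1 <= (K1 * K2)%AS)%VS by exact: field_subvMr.
have sK2 : (K2 <= (K1 * K2)%AS)%VS by exact: field_subvMl.
(* Both sides are intersections of subgroups, so each inclusion is tested on an arbitrary subgroup H
   containing the generators of the larger side. *)
apply/seteqP; split=> c Lc H [subH genH].
  apply: (polya_sub_ext galL galK1 galK2 sK1 sK2 _ _ _ tame subH) Lc.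
  - exact: subvv.
  - exact: capvSl.
  - exact: capvSr.
  - by move=> d Kd; apply: genH; left; exists d.
  - by move=> d Kd; apply: genH; right; exists d.
have HPi q : (0 < q)%N -> H (idealClass (K1 * K2)%AS (PiIdeal (K1 * K2)%AS q)).
  by move=> q_gt0; apply: genH; exists q.
apply: (Lc H); split=> // _ [[d Kd <-]|[d Kd <-]].
  exact: (polya_ext galL galK1 sK1 subH HPi).
exact: (polya_ext galL galK2 sK2 subH HPi).
Qed.
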